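(* Let $\mathcal{H}=\mathcal{H}(X)$ be a reproducing kernel Hilbert space on a nonempty set $X$ and let $Z\in\mathcal{B}(\mathcal{H})$ have closed range. Then for every real $r\geq1$, $$\mathbf{ber}^{2r}(Z)\leq\frac14\,\mathbf{ber}\left(|Z|^{4r}+(ZZ^\dagger)^{2r}\right)+\frac12\,\mathbf{ber}\left((ZZ^\dagger)^{r}|Z|^{2r}\right).$$
   Context: A reproducing kernel Hilbert space $\mathcal{H}(X)$ is a complex Hilbert space of complex-valued functions on $X$ on which every evaluation $\phi\mapsto\phi(x)$, $x\in X$, is continuous; $k_x\in\mathcal{H}$ is the element with $\phi(x)=\langle\phi,k_x\rangle$ for all $\phi\in\mathcal{H}$, and $\hat k_x=k_x/\|k_x\|$ is the normalized reproducing kernel (for $k_x\ne0$). $\mathcal{B}(\mathcal{H})$ is the algebra of bounded linear operators on $\mathcal{H}$. The Berezin number is $\mathbf{ber}(T)=\sup_{x}|\langle T\hat k_x,\hat k_x\rangle|$, over all $x\in X$ for which $\hat k_x$ is defined; $\mathbf{ber}^p(T)$ means $(\mathbf{ber}(T))^p$. $|T|=\sqrt{T^*T}$. For a closed-range $T\in\mathcal{B}(\mathcal{H})$, $T^\dagger$ is the Moore–Penrose inverse: the unique bounded operator with $TT^\dagger T=T$, $T^\dagger TT^\dagger=T^\dagger$, $(TT^\dagger)^*=TT^\dagger$, $(T^\dagger T)^*=T^\dagger T$. Real powers of positive operators are taken via functional calculus. *)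

(* Defs.v *)
From HB Require Import structures.
From mathcomp Require Import all_boot all_order all_algebra.
From mathcomp Require Import all_classical all_reals all_analysis.
From mathcomp Require Import complex.

Set Implicit Arguments.
Unset Strict Implicit.
Unset Printing Implicit Defensive.

Import Order.TTheory GRing.Theory Num.Theory.
Import numFieldNormedType.Exports.

Local Open Scope classical_set_scope.
Local Open Scope ring_scope.
Local Open Scope complex_scope.

(* The elements of the space are functions on X through the injective linear
   map [rk_eval].  The inner product is linear in its first argument and
   conjugate-linear in the second. *)
Record rkhs (R : realType) (X : Type) := Rkhs {
  rk_space :> completeNormedModType R[i] ;
  rk_dot : {dot rk_space for Num.conj} ;
  rk_norm : forall u : rk_space, rk_dot u u = `|u| ^+ 2 ;
  rk_eval : rk_space -> X -> R[i] ;
  rk_eval_linear : forall (x : X) (a : R[i]) (u v : rk_space),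
    rk_eval (a *: u + v) x = a * rk_eval u x + rk_eval v x ;
  rk_eval_inj : injective rk_eval ;
  rk_eval_continuous : forall x : X,
    continuous (fun u : rk_space => rk_eval u x : R[i]^o)
}.

Section Operators.
Context {R : realType} {X : Type} {H : rkhs R X}.
Implicit Types A B S T : H -> H.

Definition bounded_op T : Prop :=
  linear T /\ exists M : R, forall u : H, `|T u| <= M%:C * `|u|.

(* By the Riesz representation theorem, the default value 0 of [xget] is not
   used when T is bounded. *)
Definition adj T : H -> H :=
  xget (fun=> 0) [set S | bounded_op S /\
    forall u v : H, rk_dot H (T u) v = rk_dot H u (S v)].

Definition is_mpinv T S : Prop :=
  [/\ bounded_op S,
      T \o S \o T = T,
      S \o T \o S = S,
      adj (T \o S) = T \o S &
      adj (S \o T) = S \o T].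

(* The default value 0 is used exactly when the range of T is not closed (T
   bounded). *)
Definition mpinv T : H -> H := xget (fun=> 0) [set S | is_mpinv T S].

Definition spectrum T : set R[i] :=
  [set l | ~ exists S, [/\ bounded_op S,
     forall u : H, S (T u - l *: u) = u &
     forall u : H, T (S u) - l *: S u = u]].

Definition horner_op (p : {poly R}) T : H -> H :=
  fun u => \sum_(i < size p) (p`_i)%:C *: iter i T u.

(* Continuous functional calculus of a self-adjoint operator (whose spectrum is
   real): B = f(A) when B is the limit in operator norm, that is, uniformly on
   the unit ball, of p_n(A) for real polynomials p_n that tend to f uniformly
   on the spectrum of A.  By the spectral theorem B exists for f continuous on
   the spectrum, and does not depend on the sequence p_n. *)
Definition is_fcalc (f : R -> R) A B : Prop :=
  bounded_op B /\
  exists p : nat -> {poly R},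
    {uniform [set t : R | spectrum A t%:C],
       (fun n t => (p n).[t]) @ \oo --> f} /\
    {uniform [set u : H | `|u| <= 1],
       (fun n => horner_op (p n) A) @ \oo --> B}.

Definition fcalc (f : R -> R) A : H -> H :=
  xget (fun=> 0) [set B | is_fcalc f A B].

(* Only meaningful for positive A and s > 0: [t `^ s] is not the power function
   on negative t. *)
Definition op_pow A (s : R) : H -> H := fcalc (fun t => t `^ s) A.

Definition op_abs T : H -> H := fcalc Num.sqrt (adj T \o T).

(* Exists by the Riesz representation theorem, and is unique. *)
Definition rkernel (x : X) : H :=
  xget 0 [set k : H | forall u : H, rk_eval u x = rk_dot H u k].

Definition nkernel (x : X) : H := `|rkernel x|^-1 *: rkernel x.

(* The norm of R[i] takes its values in R[i], whence the real part.  When every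
   kernel vanishes, i.e. H = 0, this is [sup set0], which is 0. *)
Definition ber T : R :=
  sup [set complex.Re `|rk_dot H (T (nkernel x)) (nkernel x)|
      | x in [set x | rkernel x != 0]].

End Operators.

(* Main.v *)
Require Import Defs.
From mathcomp Require Import all_boot all_order all_algebra.
From mathcomp Require Import all_classical all_reals all_analysis.
From mathcomp Require Import complex.
From mathcomp Require Import ring lra.

Import Order.TTheory GRing.Theory Num.Theory.
Import numFieldNormedType.Exports.

Local Open Scope classical_set_scope.
Local Open Scope ring_scope.

Set Implicit Arguments.
Unset Strict Implicit.
Unset Printing Implicit Defensive.

Local Open Scope complex_scope.

(** Why the theorem holds.  Put [A = |Z|] and [P = Z Z^+], the orthogonal
    projection on the range of [Z], where [Z^+] is the Moore-Penrose inverse, and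
    let [k] be a unit vector.  As [P Z = Z], the Cauchy-Schwarz inequality gives
    [|<Z k, k>| ^ 2 = |<Z k, P k>| ^ 2 <= <A ^ 2 k, k> <P k, k>].  Raise this to the
    power [r].  The Hölder-McCarthy inequality ([hoelder_mccarthy]) bounds
    [<A ^ 2 k, k> ^ r] by [<A ^ (2 r) k, k>], and [<P k, k> ^ r <= <P k, k>] because
    [<P k, k> <= 1].  Buzano's inequality ([buzano]) bounds the product
    [<A ^ (2 r) k, k> <k, P k>] by half of
    [|A ^ (2 r) k| |P k| + |<A ^ (2 r) k, P k>|].  The first summand is at most half
    of [|A ^ (2 r) k| ^ 2 + |P k| ^ 2 = <(A ^ (4 r) + P) k, k>], the second one is
    [|<P A ^ (2 r) k, k>|], and [P ^ s = P] for every [s > 0].  This is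
    [mpinv_quadratic_form]; it remains to take the supremum over the normalized
    kernels.

    Each operator of the statement is the choice of an element of a set that must
    be shown to be nonempty.  For the adjoint this is Riesz's theorem ([adjP]).  For
    the Moore-Penrose inverse ([mpinv_exists]) the uniform boundedness principle
    shows that the adjoint of [Z] is bounded below on the range of [Z], and the
    inverse is then given by a formula.

    The functional calculus of a symmetric operator [A] rests on
    [spectral_bound]: for a real polynomial [p], the norm of [p(A)] is at most the
    supremum of [|p|] on the spectrum.  Indeed, for a symmetric [T] of norm [N > 0]
    the operator [T ^ 2 - N ^ 2] is not invertible ([opnorm_sqr_spectrum]); for
    [T = p(A)], splitting [p ^ 2 - N ^ 2] into complex linear factors then yields a
    point [t] of the spectrum of [A] with [|p(t)| = N].  Uniqueness, products
    and order properties of [f(A)] follow by passing to the limit ([fcalc_dist],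
    [fcalc_mul], [fcalc_ge_poly]).  Existence ([fcalcP]) for the square root and for
    the powers follows from the Weierstrass theorem ([weierstrass]). *)

(** * Norms with real values, and the inner product *)

(** The norm of a normed module over [R[i]] takes its values in [R[i]]; this is
    the same norm as a real number. *)
Definition rnorm {R : realType} {V : normedZmodType R[i]} (u : V) : R :=
  complex.Re `|u|.

Local Notation "`‖ u ‖" := (rnorm u) (at level 0, u at level 99, format "`‖ u ‖").

Section RealNorm.
Context {R : realType} {V : normedZmodType R[i]}.
Implicit Types u v w : V.

Lemma normCE u : `|u| = `‖u‖%:C.
Proof. by rewrite /rnorm RRe_real ?ger0_real. Qed.

Lemma rnorm_ge0 u : 0 <= `‖u‖.
Proof. by rewrite -ler0c -normCE. Qed.

Lemma rnorm0 : `‖(0 : V)‖ = 0.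
Proof. by rewrite /rnorm normr0. Qed.

Lemma rnorm_eq0 u : `‖u‖ = 0 -> u = 0.
Proof. by move=> u0; apply/normr0_eq0; rewrite normCE u0. Qed.

Lemma rnorm_gt0 u : u != 0 -> 0 < `‖u‖.
Proof.
move=> u0; rewrite lt_neqAle rnorm_ge0 andbT eq_sym.
by apply: contra u0 => /eqP/rnorm_eq0 ->.
Qed.

Lemma rnorm_le0 u : `‖u‖ <= 0 -> u = 0.
Proof.
by move=> u0; apply: rnorm_eq0; apply/eqP; rewrite eq_le u0 rnorm_ge0.
Qed.

Lemma rnormN u : `‖- u‖ = `‖u‖.
Proof. by rewrite /rnorm normrN. Qed.

Lemma rnormD u v : `‖u + v‖ <= `‖u‖ + `‖v‖.
Proof. by rewrite -lecR rmorphD /= -!normCE ler_normD. Qed.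

Lemma rdistC u v : `‖u - v‖ = `‖v - u‖.
Proof. by rewrite -rnormN opprB. Qed.

Lemma rdistD w u v : `‖u - v‖ <= `‖u - w‖ + `‖w - v‖.
Proof. by rewrite (le_trans _ (rnormD _ _))// addrA subrK. Qed.

Lemma rdist_le0 u v : `‖u - v‖ <= 0 -> u = v.
Proof. by move=> /rnorm_le0/eqP; rewrite subr_eq0 => /eqP. Qed.

Lemma le_rdist u v : `‖u‖ - `‖v‖ <= `‖u - v‖.
Proof. by rewrite lerBlDr (le_trans _ (rnormD _ _))// subrK. Qed.

End RealNorm.

Lemma ler_eps {R : realType} (x y : R) :
  (forall e : R, 0 < e -> x <= y + e) -> x <= y.
Proof. by move=> xy; apply/ler_addgt0Pr. Qed.

Section ComplexNorm.
Context {R : realType}.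
Implicit Types a b : R[i].

Lemma rnormM a b : `‖a * b‖ = `‖a‖ * `‖b‖.
Proof. by apply: complexI; rewrite rmorphM /= -!normCE normrM. Qed.

Lemma rnorm_real (t : R) : `‖t%:C‖ = `|t|.
Proof. by apply: complexI; rewrite -normCE normc_def /= expr0n/= addr0 sqrtr_sqr. Qed.

Lemma rnorm_sq a : a * conjc a = (`‖a‖ ^+ 2)%:C.
Proof. by rewrite rmorphXn /= -normCE sqr_normc. Qed.

Lemma ler_Re a : `|complex.Re a| <= `‖a‖.
Proof. by rewrite -lecR -normCE normc_ge_Re. Qed.

Lemma le_Re_rnorm a : complex.Re a <= `‖a‖.
Proof. exact: le_trans (ler_norm _) (ler_Re _). Qed.

Lemma ReD a b : complex.Re (a + b) = complex.Re a + complex.Re b.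
Proof. by case: a; case: b. Qed.

Lemma ReN a : complex.Re (- a) = - complex.Re a.
Proof. by case: a. Qed.

Lemma ReB a b : complex.Re (a - b) = complex.Re a - complex.Re b.
Proof. by rewrite ReD ReN. Qed.

Lemma Re_mulr (t : R) a : complex.Re (t%:C * a) = t * complex.Re a.
Proof. by case: a => x y /=; rewrite mul0r subr0. Qed.

Lemma conjMr (t : R) a : conjc (t%:C * a) = t%:C * conjc a.
Proof. by rewrite [LHS](rmorphM (@conjc R)) /= oppr0. Qed.

Lemma addcJr a : a + conjc a = (2 * complex.Re a)%:C.
Proof. by rewrite addcJ rmorphM -[X in X * _ = _](rmorph_nat (real_complex R)). Qed.

End ComplexNorm.

Local Notation "'⟨' u , v '⟩'" := (rk_dot _ u v) (format "⟨ u ,  v ⟩").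

Section InnerProduct.
Context {R : realType} {X : Type} {H : rkhs R X}.
Implicit Types (u v w : H) (a : R[i]) (t : R).

Lemma dotDl u v w : ⟨u + v, w⟩ = ⟨u, w⟩ + ⟨v, w⟩.
Proof. exact: linearDl. Qed.
Lemma dotDr u v w : ⟨w, u + v⟩ = ⟨w, u⟩ + ⟨w, v⟩.
Proof. exact: linearDr. Qed.
Lemma dotNl u v : ⟨- u, v⟩ = - ⟨u, v⟩.
Proof. exact: linearNl. Qed.
Lemma dotNr u v : ⟨u, - v⟩ = - ⟨u, v⟩.
Proof. exact: linearNr. Qed.
Lemma dotBl u v w : ⟨u - v, w⟩ = ⟨u, w⟩ - ⟨v, w⟩.
Proof. exact: linearBl. Qed.
Lemma dotBr u v w : ⟨w, u - v⟩ = ⟨w, u⟩ - ⟨w, v⟩.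
Proof. exact: linearBr. Qed.
Lemma dotZl a u v : ⟨a *: u, v⟩ = a * ⟨u, v⟩.
Proof. exact: linearZl_LR. Qed.
Lemma dotZr a u v : ⟨u, a *: v⟩ = conjc a * ⟨u, v⟩.
Proof. exact: linearZr_LR. Qed.
Lemma dot0l u : ⟨0, u⟩ = 0.
Proof. exact: linear0l. Qed.
Lemma dot0r u : ⟨u, 0⟩ = 0.
Proof. exact: linear0r. Qed.
Lemma dotC u v : ⟨u, v⟩ = conjc ⟨v, u⟩.
Proof. by rewrite hermC /= expr0 mul1r. Qed.

Lemma dotuu u : ⟨u, u⟩ = (`‖u‖ ^+ 2)%:C.
Proof. by rewrite rk_norm normCE rmorphXn. Qed.

Lemma rnormZ a u : `‖a *: u‖ = `‖a‖ * `‖u‖.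
Proof. by apply: complexI; rewrite rmorphM /= -!normCE normrZ. Qed.

Lemma rnormZr t u : `‖t%:C *: u‖ = `|t| * `‖u‖.
Proof. by rewrite rnormZ rnorm_real. Qed.

Lemma rnormD_sq u v :
  `‖u + v‖ ^+ 2 = `‖u‖ ^+ 2 + `‖v‖ ^+ 2 + 2 * complex.Re ⟨u, v⟩.
Proof.
apply: complexI; rewrite -dotuu dotDl !dotDr !dotuu (dotC v u) !rmorphD /=.
by rewrite -addcJr; ring.
Qed.

Lemma rnormB_sq u v :
  `‖u - v‖ ^+ 2 = `‖u‖ ^+ 2 + `‖v‖ ^+ 2 - 2 * complex.Re ⟨u, v⟩.
Proof. by rewrite rnormD_sq rnormN dotNr ReN mulrN. Qed.

Lemma vnormD u v : `‖u + v‖ <= `‖u‖ + `‖v‖.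
Proof. exact: rnormD. Qed.

Lemma vdistC u v : `‖u - v‖ = `‖v - u‖.
Proof. exact: rdistC. Qed.

Lemma vdistD w u v : `‖u - v‖ <= `‖u - w‖ + `‖w - v‖.
Proof. exact: rdistD. Qed.

Lemma parallelogram u v :
  `‖u + v‖ ^+ 2 + `‖u - v‖ ^+ 2 = 2 * (`‖u‖ ^+ 2 + `‖v‖ ^+ 2).
Proof. by rewrite rnormD_sq rnormB_sq; ring. Qed.

(** Pythagoras for the part of [u] orthogonal to [v].  For [v = 0] the coefficient
    is [0], as the inverse of [0] is [0]. *)
Lemma rnorm_orth_part u v :
  `‖u - ((`‖v‖ ^+ 2)^-1%:C * ⟨u, v⟩) *: v‖ ^+ 2 =
  `‖u‖ ^+ 2 - `‖⟨u, v⟩‖ ^+ 2 / `‖v‖ ^+ 2.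
Proof.
have [->|v0] := eqVneq v 0.
  by rewrite dot0r !rnorm0 scaler0 subr0 expr0n mul0r subr0.
have nv : `‖v‖ != 0 by apply: contra v0 => /eqP/rnorm_eq0 ->.
set t := (`‖v‖ ^+ 2)^-1.
have Et (z : R[i]) : conjc (t%:C * z) * z = (t * `‖z‖ ^+ 2)%:C.
  by rewrite conjMr -mulrA [conjc _ * _]mulrC rnorm_sq -rmorphM.
rewrite rnormB_sq rnormZ rnormM rnorm_real dotZr Et /=.
rewrite ger0_norm ?invr_ge0 ?exprn_ge0 ?rnorm_ge0// /t {t Et}.
by field.
Qed.

(** The squared norm of the part of [u] orthogonal to [v] is nonnegative. *)
Lemma cauchy_schwarz u v : `‖⟨u, v⟩‖ <= `‖u‖ * `‖v‖.
Proof.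
have [->|/rnorm_gt0 nv] := eqVneq v 0; first by rewrite dot0r !rnorm0 mulr0.
rewrite -(@ler_pXn2r _ 2)// ?nnegrE ?mulr_ge0 ?rnorm_ge0// exprMn.
rewrite -ler_pdivrMr ?exprn_gt0// -subr_ge0 -rnorm_orth_part.
by rewrite exprn_ge0 ?rnorm_ge0.
Qed.

Lemma dot_ext u v : (forall w, ⟨w, u⟩ = ⟨w, v⟩) -> u = v.
Proof.
move=> uv; apply/eqP; rewrite -subr_eq0; apply/eqP/rnorm_eq0/eqP.
by rewrite -sqrf_eq0; apply/eqP/complexI; rewrite -dotuu dotBr uv subrr.
Qed.

End InnerProduct.

(** * Orthogonal projections and the Riesz representation theorem *)

Section Completeness.
Context {R : realType} {X : Type} {H : rkhs R X}.
Implicit Types (u v w : H).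

Lemma gt0_complexP (e : R[i]) : 0 < e -> exists2 r : R, 0 < r & e = r%:C.
Proof. by case: e => r s; rewrite ltcE => /andP[/eqP/= -> r0]; exists r. Qed.

Lemma cvgnP (u : nat -> H) (l : H) :
  u @ \oo --> l <->
  (forall e : R, 0 < e -> exists N, forall n, (N <= n)%N -> `‖l - u n‖ < e).
Proof.
split=> [/cvgrPdist_lt ul e e0|ul].
  have /ul : 0 < e%:C by rewrite ltcR.
  case=> N _ uN; exists N => n Nn.
  by have := uN n Nn; rewrite /= normCE ltcR.
apply/cvgrPdist_lt => _ /gt0_complexP[e {}/ul[N ulN] ->].
by exists N => // n /ulN /=; rewrite normCE ltcR.
Qed.

Lemma rkhs_complete (u : nat -> H) :
  (forall e : R, 0 < e -> exists N, forall n, (N <= n)%N -> `‖u N - u n‖ < e) ->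
  exists l : H, u @ \oo --> l.
Proof.
move=> cu; suff: [cvg (u @ \oo) in H] by move/cvg_ex.
apply: cauchy_cvg; apply/cauchyP => _ /gt0_complexP[e {}/cu[N cuN] ->].
by exists (u N), N => // n /cuN; rewrite -ball_normE /ball_/= normCE ltcR.
Qed.

Lemma cvgn_unique (u : nat -> H) (l l' : H) :
  u @ \oo --> l -> u @ \oo --> l' -> l = l'.
Proof. by apply: cvg_unique; exact: norm_hausdorff. Qed.

End Completeness.

Section Projection.
Context {R : realType} {X : Type} {H : rkhs R X}.
Implicit Types (u v w : H).

(** The projection theorem.  A minimizing sequence for the distance from [y] is
    Cauchy by the parallelogram law, and the minimizer [m] has [y - m] orthogonal
    to [M], since removing from [y - m] its component along a vector of [M]
    cannot shorten it. *)
Lemma orthogonal_projection (M : set H) :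
  M 0 -> (forall a u v, M u -> M v -> M (a *: u + v)) ->
  (forall (u : nat -> H) (l : H), (forall n, M (u n)) -> u @ \oo --> l -> M l) ->
  forall y : H, exists2 m : H, M m & forall v, M v -> ⟨y - m, v⟩ = 0.
Proof.
move=> M0 Mlin Mcl y.
pose D : set R := [set `‖y - m‖ | m in M].
have D0 : has_inf D.
  split; first by exists `‖y - 0‖, 0.
  by exists 0 => _ [m _ <-]; exact: rnorm_ge0.
pose d : R := inf D.
have dle m : M m -> d <= `‖y - m‖ by move=> Mm; apply: (ge_inf D0.2); exists m.
have d0 : 0 <= d by apply: lb_le_inf D0.1 _ => _ [m _ <-]; exact: rnorm_ge0.
have /choice[u uP] n : exists m : H, M m /\ `‖y - m‖ < d + n.+1%:R^-1.
  by have [|_ [m Mm <-]] := @inf_adherent _ D n.+1%:R^-1 _ D0; [rewrite invr_gt0|exists m].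
clearbody d.
have mid N n : (N <= n)%N -> `‖u N - u n‖ ^+ 2 <= (8 * d + 4) / N.+1%:R.
  (* both distances to [y] are at most [d + s], that of the midpoint at least [d] *)
  move=> Nn; set s : R := N.+1%:R^-1.
  have s0 : 0 < s by rewrite invr_gt0.
  have s1 : s <= 1 by rewrite invf_le1// ler1n.
  have [MN uN] := uP N; have [Mn un] := uP n.
  have {}un : `‖y - u n‖ < d + s.
    by apply: (lt_le_trans un); rewrite lerD2l lef_pV2 ?posrE// ler_nat.
  have := parallelogram (y - u N) (y - u n).
  have -> : y - u N - (y - u n) = u n - u N by rewrite opprB addrC addrA subrK.
  have -> : y - u N + (y - u n) =
      2%:C *: (y - (2^-1%:C *: u N + 2^-1%:C *: u n)).
    rewrite scalerBr scalerDr !scalerA -!rmorphM /= mulfV// !scale1r opprD addrACA.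
    by rewrite rmorph_nat scaler_nat mulr2n.
  rewrite rnormZr (vdistC (u n)) ger0_norm// exprMn.
  have : d <= `‖y - (2^-1%:C *: u N + 2^-1%:C *: u n)‖.
    by apply/dle/Mlin => //; rewrite -[_ *: u n]addr0; apply: Mlin.
  move: uN un; rewrite -/s.
  have := rnorm_ge0 (y - u N); have := rnorm_ge0 (y - u n).
  set a := `‖_‖; set b := `‖_‖; set c := `‖_‖; set e := `‖_‖ => a0 b0 ad bd dc.
  have ds0 : 0 <= d + s by rewrite addr_ge0// ltW.
  have : a ^+ 2 <= (d + s) ^+ 2 by rewrite ler_pXn2r ?nnegrE// ltW.
  have : b ^+ 2 <= (d + s) ^+ 2 by rewrite ler_pXn2r ?nnegrE// ltW.
  have : d ^+ 2 <= c ^+ 2 by rewrite ler_pXn2r ?nnegrE// (le_trans d0).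
  nra.
have [|m um] := (@rkhs_complete _ _ _ u).
  move=> e e0.
  have [N] : exists N, (8 * d + 4) / N.+1%:R < e ^+ 2.
    exists (Num.truncn ((8 * d + 4) / e ^+ 2)).
    by rewrite ltr_pdivrMr// -ltr_pdivrMl ?exprn_gt0// [_^-1 * _]mulrC truncnS_gt.
  move=> Ne; exists N => n Nn; rewrite -(@ltr_pXn2r _ 2)// ?nnegrE ?rnorm_ge0// ?ltW//.
  exact: le_lt_trans (mid _ _ Nn) Ne.
have Mm : M m by apply: Mcl um => n; exact: (uP n).1.
have ymd : `‖y - m‖ <= d.
  apply: ler_eps => e e0; have e20 : 0 < e / 2 by rewrite divr_gt0.
  have [N uN] := (cvgnP _ _).1 um _ e20.
  pose n := maxn N (Num.truncn (e / 2)^-1).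
  have : `‖m - u n‖ < e / 2 by apply: uN; exact: leq_maxl.
  have := (uP n).2.
  have : n.+1%:R^-1 <= e / 2.
    rewrite -[e / 2]invrK lef_pV2 ?posrE ?invr_gt0// (le_trans (ltW (truncnS_gt _)))//.
    by rewrite ler_nat ltnS leq_maxr.
  have := vdistD (u n) y m; rewrite (vdistC (u n)); move: (n.+1%:R^-1 : R) => s; lra.
exists m => // v Mv; apply: rnorm_eq0.
have [->|/rnorm_gt0 nv] := eqVneq v 0; first by rewrite dot0r rnorm0.
have := rnorm_orth_part (y - m) v; set c := _ * ⟨_, _⟩ => E.
have : d ^+ 2 <= `‖y - m - c *: v‖ ^+ 2.
  rewrite ler_pXn2r ?nnegrE ?rnorm_ge0// -addrA -opprD.
  by apply: dle; rewrite addrC; exact: Mlin.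
rewrite E => dE.
have {dE} : `‖⟨y - m, v⟩‖ ^+ 2 / `‖v‖ ^+ 2 <= 0.
  have : `‖y - m‖ ^+ 2 <= d ^+ 2 by rewrite ler_pXn2r ?nnegrE ?rnorm_ge0.
  lra.
rewrite pmulr_lle0 ?invr_gt0 ?exprn_gt0// => le0.
by apply/eqP; rewrite -sqrf_eq0 eq_le le0 exprn_ge0 ?rnorm_ge0.
Qed.

(** The Riesz representation theorem: a vector orthogonal to the kernel of
    [phi] represents it up to a scalar. *)
Lemma riesz (phi : H -> R[i]) :
  (forall a u v, phi (a *: u + v) = a * phi u + phi v) ->
  (exists M : R, forall u, `‖phi u‖ <= M * `‖u‖) ->
  exists w, forall u, phi u = ⟨u, w⟩.
Proof.
move=> philin [M phiM].
have phi0 : phi 0 = 0.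
  by apply: rnorm_eq0; apply/eqP; rewrite eq_le rnorm_ge0 (le_trans (phiM _))// rnorm0 mulr0.
have phiB u v : phi (u - v) = phi u - phi v.
  by rewrite addrC -scaleN1r philin mulN1r addrC.
have [[y y0]|nz] := pselect (exists y, phi y <> 0); last first.
  by exists 0 => u; rewrite dot0r; apply: contrapT => pu; apply: nz; exists u.
have [|||m m0 mo] := @orthogonal_projection [set u : H | phi u = 0] _ _ _ y => //=.
- by move=> a u v; rewrite philin => -> ->; rewrite mulr0 addr0.
- move=> u l u0 ul; apply: rnorm_eq0; apply/eqP; rewrite eq_le rnorm_ge0 andbT.
  apply: ler_eps => e e0; rewrite add0r.
  have e0' : 0 < e / (`|M| + 1) by rewrite divr_gt0// ltr_wpDl.
  have [N uN] := (cvgnP _ _).1 ul _ e0'.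
  have := uN N (leqnn N); rewrite ltr_pdivlMr ?ltr_wpDl// => h.
  rewrite -[phi l]subr0 -(u0 N) -phiB (le_trans (phiM _))//.
  rewrite (le_trans _ (ltW h))// mulrC ler_wpM2l ?rnorm_ge0//.
  by have := ler_norm M; lra.
pose w := y - m.
have phiw : phi w = phi y by rewrite phiB m0 subr0.
have nw : `‖w‖ ^+ 2 != 0.
  rewrite sqrf_eq0; apply/eqP => /rnorm_eq0 w0; apply: y0.
  by rewrite -phiw w0.
exists (((`‖w‖ ^+ 2)^-1%:C * conjc (phi w)) *: w) => u.
rewrite dotZr conjMr conjcK.
have : ⟨w, phi u *: w - phi w *: u⟩ = 0.
  apply: mo; rewrite /= phiB -[_ *: w]addr0 -[_ *: u]addr0 !philin phi0 !addr0.
  by rewrite mulrC subrr.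
rewrite dotC dotBl !dotZl dotuu => /eqP; rewrite conjc_eq0 subr_eq0 => /eqP E.
by rewrite -mulrA -E mulrCA -rmorphM mulVf// rmorph1 mulr1.
Qed.

End Projection.

(** * Bounded operators, adjoints and invertibility *)

Section BoundedOperators.
Context {R : realType} {X : Type} {H : rkhs R X}.
Implicit Types (u v w : H) (a : R[i]) (A B S T : H -> H).

Lemma linearT_B T u v : linear T -> T (u - v) = T u - T v.
Proof. by move=> lT; rewrite addrC -scaleN1r lT scaleN1r addrC. Qed.

Lemma linearT_0 T : linear T -> T 0 = 0.
Proof. by move=> lT; rewrite -[X in T X](subrr 0) linearT_B// subrr. Qed.

Lemma linearT_Z T a u : linear T -> T (a *: u) = a *: T u.
Proof. by move=> lT; rewrite -[a *: u]addr0 lT linearT_0// addr0. Qed.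

Lemma linearT_D T u v : linear T -> T (u + v) = T u + T v.
Proof. by move=> lT; rewrite -[u]scale1r lT !scale1r. Qed.

Lemma bounded_opP T : bounded_op T ->
  linear T /\ exists2 M : R, 0 <= M & forall u, `‖T u‖ <= M * `‖u‖.
Proof.
move=> [lT [M TM]]; split=> //; exists `|M| => // u.
have := TM u; rewrite !normCE -rmorphM lecR => /le_trans; apply.
by rewrite ler_wpM2r ?rnorm_ge0// ler_norm.
Qed.

Lemma bounded_opI T (M : R) : linear T -> (forall u, `‖T u‖ <= M * `‖u‖) ->
  bounded_op T.
Proof.
by move=> lT TM; split=> //; exists M => u; rewrite !normCE -rmorphM lecR.
Qed.

Lemma bounded_id : bounded_op (id : H -> H).
Proof. by apply: (@bounded_opI _ 1) => // u; rewrite mul1r. Qed.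

Lemma bounded_scale a : bounded_op (fun u : H => a *: u).
Proof.
apply: (@bounded_opI _ `‖a‖) => [b u v|u]; last by rewrite rnormZ.
by rewrite scalerDr !scalerA mulrC.
Qed.

Lemma bounded_comp S T : bounded_op S -> bounded_op T -> bounded_op (S \o T).
Proof.
move=> /bounded_opP[lS [M M0 SM]] /bounded_opP[lT [N N0 TN]].
apply: (@bounded_opI _ (M * N)) => [a u v|u] /=; first by rewrite lT lS.
by rewrite (le_trans (SM _))// -mulrA ler_wpM2l.
Qed.

Lemma bounded_lin a S T : bounded_op S -> bounded_op T ->
  bounded_op (fun u => a *: S u + T u).
Proof.
move=> /bounded_opP[lS [M M0 SM]] /bounded_opP[lT [N N0 TN]].
apply: (@bounded_opI _ (`‖a‖ * M + N)) => [b u v|u] /=.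
  by rewrite lT lS !scalerDr !scalerA addrACA [b * a]mulrC.
rewrite (le_trans (vnormD _ _))// mulrDl lerD// rnormZ -mulrA.
by rewrite ler_wpM2l// rnorm_ge0.
Qed.

Lemma bounded_sub_scale a T : bounded_op T -> bounded_op (fun u => T u - a *: u).
Proof.
move=> bT; rewrite (_ : (fun _ => _) = fun u => (- a) *: id u + T u); last first.
  by apply/funext => u; rewrite scaleNr addrC.
by apply: bounded_lin => //; exact: bounded_id.
Qed.

(** Riesz's theorem represents the functionals [u |-> <T u, v>]. *)
Lemma adjP T : bounded_op T ->
  bounded_op (adj T) /\ forall u v, ⟨T u, v⟩ = ⟨u, adj T v⟩.
Proof.
move=> bT; apply: (@xgetPex _ (fun=> 0) [set S | bounded_op S /\
  forall u v : H, rk_dot H (T u) v = rk_dot H u (S v)]).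
have [lT [M M0 TM]] := bounded_opP bT.
have /choice[S TS] v : exists w : H, forall u, ⟨T u, v⟩ = ⟨u, w⟩.
  apply: riesz => [a u w|]; first by rewrite lT dotDl dotZl.
  exists (M * `‖v‖) => u; rewrite (le_trans (cauchy_schwarz _ _))//.
  by rewrite mulrAC ler_wpM2r ?rnorm_ge0.
exists S; split=> //; apply: (@bounded_opI _ M).
  move=> a u v; apply: dot_ext => w.
  by rewrite -TS dotDr dotZr TS dotDr dotZr TS.
move=> v; have [->|/rnorm_gt0 nSv] := eqVneq (S v) 0.
  by rewrite rnorm0 mulr_ge0 ?rnorm_ge0.
rewrite -(ler_pM2l nSv) -expr2.
have := dotuu (S v); rewrite -TS => /(congr1 (@complex.Re R)) /= <-.
rewrite (le_trans (le_Re_rnorm _))// (le_trans (cauchy_schwarz _ _))//.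
by rewrite mulrA ler_wpM2r ?rnorm_ge0// mulrC.
Qed.

Lemma adj_unique T S : bounded_op T -> (forall u v, ⟨T u, v⟩ = ⟨u, S v⟩) ->
  adj T = S.
Proof.
move=> bT TS; apply/funext => v; apply: dot_ext => u.
by rewrite -(adjP bT).2.
Qed.

Definition symmetric_op T := forall u v, ⟨T u, v⟩ = ⟨u, T v⟩.

Lemma symmetric_adj T : bounded_op T -> adj T = T -> symmetric_op T.
Proof. by move=> bT aT u v; rewrite (adjP bT).2 aT. Qed.

Definition invertible_op T := exists S : H -> H,
  [/\ bounded_op S, forall u, S (T u) = u & forall u, T (S u) = u].

Lemma invertible_comp S T :
  invertible_op S -> invertible_op T -> invertible_op (S \o T).
Proof.
move=> [S' [bS S'S SS']] [T' [bT T'T TT']]; exists (T' \o S'); split.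
- exact: bounded_comp.
- by move=> u /=; rewrite S'S T'T.
- by move=> u /=; rewrite TT' SS'.
Qed.

(** An operator that is bounded below has closed range, and the orthogonal
    complement of the range is the kernel of the adjoint. *)
Lemma bounded_below_invertible S T (c : R) :
  bounded_op S -> (forall u v, ⟨S u, v⟩ = ⟨u, T v⟩) ->
  0 < c -> (forall u, c * `‖u‖ <= `‖S u‖) -> (forall u, T u = 0 -> u = 0) ->
  invertible_op S.
Proof.
move=> bS ST c0 Sc T0; have [lS [M M0 SM]] := bounded_opP bS.
have cS u v : `‖u - v‖ <= c^-1 * `‖S u - S v‖.
  by rewrite ler_pdivlMl// -linearT_B.
have /choice[S' SS'] y : exists u, S u = y.
  have [|||m [u _ Su] mo] := @orthogonal_projection _ _ H (range S) _ _ _ y.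
  - by exists 0; rewrite ?linearT_0.
  - by move=> a _ _ [u _ <-] [v _ <-]; exists (a *: u + v); rewrite ?lS.
  - move=> y_ l y_S yl.
    have /choice[x xy] n : exists x : H, S x = y_ n.
      by have [x _ <-] := y_S n; exists x.
    have [|z xz] := (@rkhs_complete _ _ _ x).
      move=> e e0; have ce0 : 0 < c * e / 2 by rewrite divr_gt0// mulr_gt0.
      have [N yN] := (cvgnP _ _).1 yl _ ce0; exists N => n Nn.
      rewrite (le_lt_trans (cS _ _))// !xy ltr_pdivrMl//.
      rewrite (le_lt_trans (vdistD l _ _))//.
      by have := yN _ (leqnn N); have := yN _ Nn; rewrite (vdistC (y_ N)); lra.
    exists z => //; apply: cvgn_unique yl; apply/cvgnP => e e0.
    have Me0 : 0 < e / (M + 1) by rewrite divr_gt0// ltr_wpDl.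
    have [N xN] := (cvgnP _ _).1 xz _ Me0; exists N => n /xN.
    rewrite ltr_pdivlMr ?ltr_wpDl// => h; rewrite -xy -linearT_B//.
    rewrite (le_lt_trans (SM _))// (le_lt_trans _ h)// mulrC ler_wpM2l ?rnorm_ge0//.
    by rewrite lerDl.
  - exists u; apply/eqP; rewrite Su eq_sym -subr_eq0; apply/eqP/T0.
    by apply: dot_ext => v; rewrite -ST dot0r dotC mo ?conjc0.
have S'S u : S' (S u) = u.
  apply: rdist_le0; rewrite (le_trans (cS _ _))//.
  by rewrite SS' subrr rnorm0 mulr0.
exists S'; split=> //; apply: (@bounded_opI _ c^-1).
  by move=> a u v; rewrite -[LHS]S'S SS' -{1}(SS' u) -{1}(SS' v) -lS !S'S.
by move=> u; rewrite ler_pdivlMl// (le_trans (Sc _))// SS'.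
Qed.

End BoundedOperators.

(** * The Moore-Penrose inverse *)

Section MoorePenrose.
Context {R : realType} {X : Type} {H : rkhs R X}.
Implicit Types (u v w x y z : H) (Z S P W : H -> H).

(** The inner products with [y] of the two translates of [x] by a vector of length
    [s] parallel to [y] differ by [2 * s * `‖y‖]. *)
Lemma large_dot_nearby (y : H) (s : R) x : y != 0 -> 0 <= s ->
  exists x' : H, `‖x - x'‖ <= s /\ s * `‖y‖ <= `‖⟨x', y⟩‖.
Proof.
move=> /rnorm_gt0 y0 s0; pose p := (s / `‖y‖)%:C *: y.
have np : `‖p‖ = s.
  by rewrite rnormZr ger0_norm ?divfK ?gt_eqF// divr_ge0// ltW.
have E : ⟨x + p, y⟩ - ⟨x - p, y⟩ = (2 * (s * `‖y‖))%:C.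
  rewrite -dotBl opprB [_ + (p - x)]addrC addrA subrK -scalerDl -rmorphD dotZl.
  by rewrite dotuu -rmorphM; congr _%:C; field; rewrite gt_eqF.
have : 2 * (s * `‖y‖) <= `‖⟨x + p, y⟩‖ + `‖⟨x - p, y⟩‖.
  rewrite -[`‖⟨x - p, y⟩‖]rnormN (le_trans _ (rnormD _ _))// E rnorm_real.
  exact: ler_norm.
have [le1 _|lt1 le2] := lerP (s * `‖y‖) `‖⟨x + p, y⟩‖.
  by exists (x + p); rewrite opprD addrA subrr sub0r rnormN np.
exists (x - p); rewrite opprB addrC subrK np; split=> //.
by rewrite -(lerD2l (s * `‖y‖)) -mulr2n -mulr_natl (le_trans le2)// lerD2r ltW.
Qed.

(** The uniform boundedness principle for the functionals [<., y>].  Following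
    Sokal, if the norms of [Y] are unbounded then a geometrically convergent
    sequence of translations of size [3 ^- n], each making the inner product
    with some [y n] of norm above [n * 3 ^ n] large, has a limit [l] at which
    [Y] is not bounded. *)
Lemma uniform_boundedness (Y : set H) :
  (forall v : H, exists M : R, forall y, Y y -> `‖⟨v, y⟩‖ <= M) ->
  exists C : R, forall y, Y y -> `‖y‖ <= C.
Proof.
move=> Yb; apply: contrapT => nC.
pose s n : R := 3^-1 ^+ n.
have s0 n : 0 < s n by rewrite exprn_gt0.
have sS n : s n.+1 = s n / 3 by rewrite /s exprSr.
have /choice[y yP] n : exists y, Y y /\ n%:R < s n * `‖y‖.
  apply: contrapT => ny; apply: nC; exists (n%:R / s n) => y Yy.
  rewrite ler_pdivlMr// leNgt; apply/negP => h; apply: ny; exists y.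
  by rewrite mulrC.
have y0 n : y n != 0.
  apply/eqP => yn; have := (yP n).2.
  by rewrite yn rnorm0 mulr0 ltNge ler0n.
have /choice[f fP] (nx : nat * H) : exists x' : H,
    `‖nx.2 - x'‖ <= s nx.1 /\ s nx.1 * `‖y nx.1‖ <= `‖⟨x', y nx.1⟩‖.
  by apply: large_dot_nearby; rewrite ?ltW.
pose x := fix x n : H := if n is m.+1 then f (m, x m) else 0.
have dx n : `‖x n - x n.+1‖ <= s n by have [] := fP (n, x n).
(* geometric sum: [s n = 3 / 2 * (s n - s n.+1)] *)
have xN N k : `‖x N - x (N + k)%N‖ <= 3 / 2 * (s N - s (N + k)%N).
  elim: k => [|k IH]; first by rewrite addn0 !subrr rnorm0 mulr0.
  rewrite (le_trans (vdistD (x (N + k)%N) _ _))// addnS.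
  have := dx (N + k)%N; rewrite sS; move: IH (s0 (N + k)%N); lra.
have xN' N n : (N <= n)%N -> `‖x N - x n‖ <= 3 / 2 * s N.
  move=> Nn; have := xN N (n - N)%N; rewrite subnKC//.
  by have := s0 n; lra.
have sN (e : R) : 0 < e -> exists N, s N < e.
  move=> e0; exists (Num.truncn e^-1).+1; rewrite /s exprVn invf_plt ?posrE ?exprn_gt0//.
  rewrite (lt_trans (truncnS_gt _))// -natrX ltr_nat.
  exact: ltn_expl.
have [|l xl] := @rkhs_complete _ _ _ x.
  move=> e e0; have [|N Ne] := sN (e / 2); first by rewrite divr_gt0.
  by exists N => n /xN' /le_lt_trans; apply; move: Ne (s0 N); lra.
(* the translations after the one made for [y n] undo at most half of its gain *)
have ln n : `‖x n.+1 - l‖ <= s n / 2.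
  apply: ler_eps => e e0; have [N lN] := (cvgnP _ _).1 xl _ e0.
  have := lN _ (leq_maxl N n.+1); have := xN' _ _ (leq_maxr N n.+1).
  have := vdistD (x (maxn N n.+1)) (x n.+1) l.
  rewrite (vdistC l) sS; lra.
have [M lM] := Yb l.
pose n := (Num.truncn (2 * M)).+1.
have := lM _ (yP n).1; rewrite leNgt => /negP; apply.
have Mn : 2 * M < n%:R by exact: truncnS_gt.
have [_] := fP (n, x n); rewrite -/(x n.+1) /= => h.
have : `‖⟨x n.+1 - l, y n⟩‖ <= s n / 2 * `‖y n‖.
  by rewrite (le_trans (cauchy_schwarz _ _))// ler_wpM2r ?rnorm_ge0.
rewrite dotBl; have := le_rdist ⟨x n.+1, y n⟩ ⟨l, y n⟩.
move: (yP n).2 h Mn; set N : R := n%:R; set a := `‖⟨x n.+1, y n⟩‖; set b := `‖_ - _‖.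
by set c := `‖⟨l, y n⟩‖; move: (s n) `‖y n‖; clearbody N a b c => p q; lra.
Qed.

(** The orthogonality of [y - P y] to [M] characterizes [P y] in [M], whence
    linearity. *)
Lemma orthogonal_projector (M : set H) :
  M 0 -> (forall a u v, M u -> M v -> M (a *: u + v)) ->
  (forall (u : nat -> H) (l : H), (forall n, M (u n)) -> u @ \oo --> l -> M l) ->
  exists P, [/\ bounded_op P, symmetric_op P, forall u, M (P u) &
    forall u, M u -> P u = u].
Proof.
move=> M0 Mlin Mcl.
have /choice[P PP] (y : H) : exists m : H, M m /\ forall v, M v -> ⟨y - m, v⟩ = 0.
  by have [m] := orthogonal_projection M0 Mlin Mcl y; exists m.
have MP u : M (P u) by exact: (PP u).1.
have PE u m : M m -> (forall v, M v -> ⟨u - m, v⟩ = 0) -> P u = m.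
  move=> Mm um; apply/eqP; rewrite -subr_eq0; apply/eqP/rnorm_eq0/eqP.
  rewrite -sqrf_eq0; apply/eqP/complexI.
  have Md : M (P u - m) by rewrite addrC -scaleN1r; exact: Mlin.
  rewrite -dotuu -[X in ⟨X, _⟩](_ : (u - m) - (u - P u) = _); last first.
    by rewrite opprB addrC addrA subrK.
  by rewrite dotBl um// (PP u).2// subrr.
have Psym : symmetric_op P.
  move=> u v; have := (PP u).2 _ (MP v); rewrite dotBl => /eqP; rewrite subr_eq0 => /eqP ->.
  have := (PP v).2 _ (MP u); rewrite dotBl => /eqP; rewrite subr_eq0 => /eqP E.
  by rewrite dotC E -dotC.
have PM u : M u -> P u = u by move=> Mu; apply: PE => // v _; rewrite subrr dot0l.
exists P; split=> //; apply: (@bounded_opI _ _ _ _ 1) => [a u v|u].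
  apply: PE => [|w Mw]; first exact: Mlin.
  by rewrite opprD addrACA -scalerBr dotDl dotZl !(PP _).2// mulr0 addr0.
have [->|/rnorm_gt0 Pu0] := eqVneq (P u) 0; first by rewrite rnorm0 mul1r rnorm_ge0.
rewrite mul1r -(ler_pM2l Pu0) -expr2.
have := dotuu (P u); rewrite Psym PM// => /(congr1 (@complex.Re R)) /= <-.
by rewrite (le_trans (le_Re_rnorm _))// (le_trans (cauchy_schwarz _ _))// mulrC.
Qed.

(** The adjoint is bounded below on a closed range: the vectors [y] of the range
    with [`‖adj Z y‖ <= 1] form a weakly bounded set. *)
Lemma adj_bounded_below Z P : bounded_op Z -> symmetric_op P ->
  (forall u, range Z (P u)) -> (forall u, range Z u -> P u = u) ->
  exists2 c : R, 0 < c <= 1 & forall y, range Z y -> c * `‖y‖ <= `‖adj Z y‖.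
Proof.
move=> bZ Psym PZ PE; have [baZ Zadj] := adjP bZ; have [laZ _] := baZ.
have [|C CY] := @uniform_boundedness [set y | range Z y /\ `‖adj Z y‖ <= 1].
  move=> v; have [u _ uv] := PZ v; exists `‖u‖ => y [Zy y1].
  rewrite -[y]PE// -Psym -uv Zadj (le_trans (cauchy_schwarz _ _))//.
  by rewrite -[leRHS]mulr1 ler_wpM2l ?rnorm_ge0// PE.
pose D : R := `|C| + 1.
have D1 : 1 <= D by rewrite lerDr.
have D0 : 0 < D by exact: lt_le_trans D1.
exists D^-1 => [|y Zy]; first by rewrite invr_gt0 D0 invf_le1.
rewrite ler_pdivrMl//; apply: ler_eps => e e0.
(* [e] keeps [t] positive if [adj Z y = 0] *)
pose t : R := `‖adj Z y‖ + e / D.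
have eD : 0 < e / D by rewrite divr_gt0.
have t0 : 0 < t by rewrite ltr_wpDl ?rnorm_ge0.
have : `‖t^-1%:C *: y‖ <= D.
  rewrite (le_trans (CY _ _))//; last by rewrite /D; have := ler_norm C; lra.
  split; first by have [x _ <-] := Zy; exists (t^-1%:C *: x); rewrite // linearT_Z//; case: bZ.
  rewrite linearT_Z// rnormZr ger0_norm ?invr_ge0 ?(ltW t0)//.
  by rewrite ler_pdivrMl// mulr1 lerDl ltW.
rewrite rnormZr ger0_norm ?invr_ge0 ?(ltW t0)// ler_pdivrMl// => /le_trans; apply.
by rewrite mulrDl divfK ?gt_eqF// mulrC.
Qed.

(** With [P] the projection on the range of [Z], the operator
    [G = Z (adj Z) + 1 - P] is symmetric and bounded below; with [W] its inverse,
    [(adj Z) W] is the Moore-Penrose inverse, because [Z (adj Z) W = P] and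
    [(adj Z) W Z] is visibly symmetric. *)
Lemma mpinv_exists Z : bounded_op Z -> closed (range Z) ->
  exists S, is_mpinv Z S.
Proof.
move=> bZ Zcl; have [lZ _] := bZ; have [baZ Zadj] := adjP bZ; have [laZ _] := baZ.
have adjZ u v : ⟨adj Z u, v⟩ = ⟨u, Z v⟩ by rewrite dotC -Zadj -dotC.
have [||| P [bP Psym PZ PE]] := @orthogonal_projector (range Z).
- by exists 0; rewrite ?linearT_0.
- by move=> a _ _ [u _ <-] [v _ <-]; exists (a *: u + v); rewrite ?lZ.
- move=> u l uZ; apply: (@closed_cvg _ _ \oo _ u (range Z)) => //.
  by near=> n; exact: uZ.
have [lP _] := bP.
have PZE u : P (Z u) = Z u by apply: PE; exists u.
have aZP u : adj Z (P u) = adj Z u.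
  by apply: dot_ext => w; rewrite -Zadj -Psym PZE Zadj.
have [c /andP[c0 c1] cP] := adj_bounded_below bZ Psym PZ PE.
pose G u := Z (adj Z u) + (u - P u).
have bG : bounded_op G.
  rewrite (_ : G = fun u => 1 *: (Z \o adj Z) u + (fun v => (-1) *: P v + id v) u).
    apply: bounded_lin; first exact: bounded_comp.
    by apply: bounded_lin => //; exact: bounded_id.
  by apply/funext => u; rewrite /G /= scale1r scaleN1r (addrC u).
have Gsym : symmetric_op G.
  by move=> u v; rewrite /G !dotDl !dotDr dotNl dotNr Psym Zadj adjZ.
have Gc u : c ^+ 2 * `‖u‖ <= `‖G u‖.
  have [->|/rnorm_gt0 u0] := eqVneq u 0; first by rewrite rnorm0 mulr0 rnorm_ge0.
  (* [<G u, u>] is the sum of the squared norms of [adj Z (P u)] and [u - P u] *)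
  rewrite -(ler_pM2r u0) -mulrA -expr2.
  rewrite (le_trans _ (cauchy_schwarz _ _))// (le_trans _ (le_Re_rnorm _))//.
  have o : ⟨u - P u, P u⟩ = 0.
    by rewrite dotBl Psym (PE (P u))// subrr.
  rewrite /G dotDl Zadj dotuu ReD /=.
  have -> : ⟨u - P u, u⟩ = ⟨u - P u, u - P u⟩ by rewrite [RHS]dotBr o subr0.
  have -> : `‖u‖ ^+ 2 = `‖u - P u‖ ^+ 2 + `‖P u‖ ^+ 2.
    by have := rnormD_sq (u - P u) (P u); rewrite subrK o mulr0 addr0.
  rewrite dotuu /= -aZP mulrDr addrC lerD//.
    by rewrite -exprMn ler_pXn2r ?nnegrE ?mulr_ge0 ?rnorm_ge0 ?(ltW c0)// cP.
  by rewrite ler_piMl ?exprn_ge0 ?rnorm_ge0// exprn_ile1// ltW.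
have [|W [bW WG GW]] := bounded_below_invertible bG Gsym (exprn_gt0 2 c0) Gc.
  move=> u Gu; apply: rnorm_le0.
  by have := Gc u; rewrite Gu rnorm0 pmulr_rle0 ?exprn_gt0.
have [lW _] := bW.
have Wsym : symmetric_op W by move=> u v; rewrite -{1}(GW v) -Gsym GW.
have ZSP u : Z (adj Z (W u)) = P u.
  by rewrite -[in RHS](GW u) /G linearT_D// PZE linearT_B// (PE (P _))// subrr addr0.
(* [G] and hence [W] fix the vectors orthogonal to the range, and [adj Z] kills them *)
have WP u : adj Z (W (P u)) = adj Z (W u).
  have Gz : G (u - P u) = u - P u.
    rewrite /G (linearT_B _ _ laZ) aZP subrr linearT_0// add0r (linearT_B _ _ lP).
    by rewrite (PE (P u))// subrr subr0.
  have : adj Z (W (u - P u)) = 0.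
    by rewrite -{1}Gz WG (linearT_B _ _ laZ) aZP subrr.
  by rewrite (linearT_B _ _ lW) (linearT_B _ _ laZ) => /eqP; rewrite subr_eq0 => /eqP.
have bS : bounded_op (adj Z \o W) by exact: bounded_comp.
exists (adj Z \o W); split=> //.
- by apply/funext => u /=; rewrite ZSP PZE.
- by apply/funext => u /=; rewrite ZSP WP.
- apply: adj_unique; first exact: bounded_comp.
  by move=> u v /=; rewrite !ZSP.
- apply: adj_unique; first exact: bounded_comp.
  by move=> u v /=; rewrite adjZ Wsym Zadj.
Unshelve. all: by end_near. Qed.

End MoorePenrose.

(** * Polynomials in an operator *)

Section PolynomialCalculus.
Context {R : realType} {X : Type} {H : rkhs R X}.
Implicit Types (u v w : H) (a : R[i]) (A B S T : H -> H) (p q : {poly R[i]}).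

(** Complex coefficients let a polynomial in [T] split into linear factors. *)
Definition chorner p T : H -> H := fun u => \sum_(i < size p) p`_i *: iter i T u.

Lemma horner_opE (p : {poly R}) T : horner_op p T = chorner (map_poly (real_complex R) p) T.
Proof.
apply/funext => u; rewrite /horner_op /chorner size_map_poly.
by apply: eq_bigr => i _; rewrite coef_map.
Qed.

Lemma chornerE p T u n : (size p <= n)%N ->
  chorner p T u = \sum_(i < n) p`_i *: iter i T u.
Proof.
move=> pn; rewrite /chorner (big_ord_widen n (fun i => p`_i *: iter i T u))//.
rewrite big_mkcond; apply: eq_bigr => i _; case: ltnP => // h.
by rewrite nth_default// scale0r.
Qed.

Lemma chornerD p q T u : chorner (p + q) T u = chorner p T u + chorner q T u.
Proof.
rewrite (@chornerE _ _ _ (maxn (size p) (size q))) ?size_polyD//.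
rewrite (@chornerE p _ _ (maxn (size p) (size q))) ?leq_maxl//.
rewrite (@chornerE q _ _ (maxn (size p) (size q))) ?leq_maxr//.
by rewrite -big_split; apply: eq_bigr => i _; rewrite coefD scalerDl.
Qed.

Lemma chornerZ a p T u : chorner (a *: p) T u = a *: chorner p T u.
Proof.
rewrite (@chornerE _ _ _ (size p)) ?size_scale_leq// scaler_sumr.
by apply: eq_bigr => i _; rewrite coefZ scalerA.
Qed.

Lemma chornerC a T u : chorner a%:P T u = a *: u.
Proof.
by rewrite (@chornerE _ _ _ 1) ?size_polyC_leq1// big_ord1 coefC.
Qed.

Lemma chorner0 T u : chorner 0 T u = 0.
Proof. by rewrite -polyC0 chornerC scale0r. Qed.

Lemma chornerMX p T u : chorner (p * 'X) T u = chorner p T (T u).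
Proof.
rewrite (@chornerE _ _ _ (size p).+1); last first.
  by rewrite (leq_trans (size_polyMleq _ _))// size_polyX addn2.
rewrite big_ord_recl coefMX /= scale0r add0r.
by apply: eq_bigr => i _; rewrite coefMX /= -iterSr.
Qed.

Lemma chornerX T u : chorner 'X T u = T u.
Proof. by rewrite -['X]mul1r chornerMX chornerC scale1r. Qed.

Lemma chorner_linear p T : linear T -> linear (chorner p T).
Proof.
move=> lT a; elim/poly_ind: p => [|p c IH] u v.
  by rewrite !chorner0 scaler0 addr0.
rewrite !chornerD !chornerMX !chornerC lT IH !scalerDr !scalerA [c * a]mulrC.
by rewrite addrACA.
Qed.

Lemma chorner_comm p T u : linear T -> chorner p T (T u) = T (chorner p T u).
Proof.
move=> lT; elim/poly_ind: p u => [|p c IH] u.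
  by rewrite !chorner0 linearT_0.
by rewrite !chornerD !chornerMX !chornerC IH (linearT_D _ _ lT) (linearT_Z _ _ lT).
Qed.

Lemma chornerM p q T u : linear T ->
  chorner (p * q) T u = chorner p T (chorner q T u).
Proof.
move=> lT; elim/poly_ind: p u => [|p c IH] u; first by rewrite mul0r !chorner0.
rewrite mulrDl mul_polyC -mulrA [_ * q]mulrC mulrA !chornerD !chornerMX.
by rewrite IH chornerC chornerZ chorner_comm.
Qed.

Lemma chorner_bounded p T : bounded_op T -> bounded_op (chorner p T).
Proof.
move=> bT; elim/poly_ind: p => [|p c IH].
  apply: (@bounded_opI _ _ _ _ 0) => [a u v|u].
    by rewrite !chorner0 scaler0 addr0.
  by rewrite chorner0 rnorm0 mul0r.
rewrite (_ : chorner _ _ = fun u => c *: id u + (chorner p T \o T) u).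
  by apply: bounded_lin; [exact: bounded_id|exact: bounded_comp].
by apply/funext => u; rewrite chornerD chornerMX chornerC addrC.
Qed.

Lemma horner_op_symmetric (p : {poly R}) T : linear T -> symmetric_op T ->
  symmetric_op (horner_op p T).
Proof.
move=> lT sT u v; rewrite horner_opE; elim/poly_ind: p u v => [|p c IH] u v.
  by rewrite rmorph0 !chorner0 dot0l dot0r.
rewrite rmorphD rmorphM /= map_polyX map_polyC /= !chornerD !chornerMX !chornerC.
rewrite dotDl dotDr dotZl dotZr IH sT conjc_real; congr (_ + _).
by rewrite chorner_comm.
Qed.

(** Up to a nonzero scalar, [q(T)] is the product of the [T - z] over the roots
    [z] of [q]. *)
Lemma chorner_invertible q T : bounded_op T -> q != 0 ->
  (forall z, root q z -> invertible_op (fun u => T u - z *: u)) ->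
  invertible_op (chorner q T).
Proof.
move=> bT; have [lT _] := bT.
have [r ->] := closed_field_poly_normal q.
rewrite scaler_eq0 negb_or => /andP[q0 _]; move: (lead_coef q) q0 => c c0.
elim: r => [_|z r IH rP].
  rewrite big_nil; exists (fun u => c^-1 *: u); split.
  - by apply: (@bounded_opI _ _ _ _ `‖c^-1‖) => [a u v|u];
      rewrite ?rnormZ// scalerDr !scalerA mulrC.
  - by move=> u; rewrite chornerZ -polyC1 chornerC scale1r scalerA mulVf// scale1r.
  - by move=> u; rewrite chornerZ -polyC1 chornerC scale1r scalerA mulfV// scale1r.
rewrite big_cons scalerAr (_ : chorner _ T =
    (fun u => T u - z *: u) \o chorner (c *: \prod_(x <- r) ('X - x%:P)) T).
  apply: invertible_comp.
    by apply: rP; rewrite rootZ// big_cons rootM root_XsubC eqxx.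
  by apply: IH => x rx; apply: rP; move: rx; rewrite !rootZ// big_cons rootM => ->; rewrite orbT.
apply/funext => u; rewrite chornerM//= chornerD chornerX -polyCN chornerC.
by rewrite scaleNr.
Qed.

End PolynomialCalculus.

(** * The spectrum of a symmetric operator *)

Section SelfAdjointSpectrum.
Context {R : realType} {X : Type} {H : rkhs R X}.
Implicit Types (u v w : H) (a : R[i]) (A B S T : H -> H).

(** The hypothesis bounds [A - z] below by the Cauchy-Schwarz inequality, and makes
    its adjoint [A - conjc z] injective. *)
Lemma numerical_range_spectrum A z (d : R) : bounded_op A -> symmetric_op A ->
  0 < d -> (forall u, d * `‖u‖ ^+ 2 <= `‖⟨A u - z *: u, u⟩‖) -> ~ spectrum A z.
Proof.
move=> bA sA d0 dA; suff inv : invertible_op (fun u => A u - z *: u).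
  by move=> Az; exact: Az inv.
have Az0 u : ⟨A u - z *: u, u⟩ = 0 -> u = 0.
  move=> Au; have := dA u; rewrite Au rnorm0 pmulr_rle0// => u0.
  by apply/rnorm_eq0/eqP; rewrite -sqrf_eq0 eq_le u0 exprn_ge0 ?rnorm_ge0.
have adjA u v : ⟨A u - z *: u, v⟩ = ⟨u, A v - conjc z *: v⟩.
  by rewrite dotBl dotBr dotZl dotZr conjcK sA.
apply: (bounded_below_invertible (bounded_sub_scale _ bA) adjA d0).
  move=> u; have [->|/rnorm_gt0 u0] := eqVneq u 0.
    by rewrite rnorm0 mulr0 rnorm_ge0.
  by rewrite -(ler_pM2r u0) -mulrA -expr2 (le_trans (dA u))// cauchy_schwarz.
by move=> u Au; apply: Az0; rewrite adjA Au dot0r.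
Qed.

Lemma symmetric_dot_real A u : symmetric_op A -> ⟨A u, u⟩ = (complex.Re ⟨A u, u⟩)%:C.
Proof.
move=> sA; have := dotC (A u) u; rewrite -sA.
case: (rk_dot _ _ _) => x y [] /eqP; rewrite -addr_eq0 -mulr2n mulrn_eq0 /=.
by move/eqP => ->.
Qed.

Lemma symmetric_spectrum_real A z : bounded_op A -> symmetric_op A ->
  spectrum A z -> z = (complex.Re z)%:C.
Proof.
case: z => x y bA sA; have [->//|y0] := eqVneq y 0.
move/(@numerical_range_spectrum A (x +i* y) `|y|); elim => //.
  by rewrite normr_gt0.
move=> u; rewrite dotBl dotZl dotuu symmetric_dot_real// /rnorm normc_def /=.
set n := `‖u‖ ^+ 2; have n0 : 0 <= n by rewrite exprn_ge0 ?rnorm_ge0.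
rewrite sub0r !mulr0 add0r sqrrN -[X in _ * X](ger0_norm n0) -normrM -sqrtr_sqr.
by rewrite ler_wsqrtr// lerDr sqr_ge0.
Qed.

Lemma nonneg_spectrum A (t : R) : bounded_op A -> symmetric_op A ->
  (forall u, 0 <= complex.Re ⟨A u, u⟩) -> spectrum A t%:C -> 0 <= t.
Proof.
move=> bA sA A0 At; rewrite leNgt; apply/negP => t0.
apply: (@numerical_range_spectrum A t%:C (- t)) At => //; first by rewrite oppr_gt0.
move=> u; rewrite (le_trans _ (le_Re_rnorm _))// dotBl dotZl dotuu ReB Re_mulr /=.
by have := A0 u; lra.
Qed.

Lemma bounded_spectrum A (M t : R) : bounded_op A -> symmetric_op A ->
  (forall u, `‖A u‖ <= M * `‖u‖) -> spectrum A t%:C -> `|t| <= M.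
Proof.
move=> bA sA AM At; rewrite leNgt; apply/negP => tM.
apply: (@numerical_range_spectrum A t%:C (`|t| - M)) At => //; first by rewrite subr_gt0.
move=> u; rewrite dotBl dotZl dotuu rdistC (le_trans _ (le_rdist _ _))//.
rewrite rnormM !rnorm_real mulrBl [`|_ ^+ 2|]ger0_norm ?exprn_ge0 ?rnorm_ge0// lerD2l lerN2.
by rewrite (le_trans (cauchy_schwarz _ _))// expr2 mulrA ler_wpM2r ?rnorm_ge0.
Qed.

Lemma unit_ball_bound T (c : R) : linear T ->
  (forall u, `‖u‖ <= 1 -> `‖T u‖ <= c) -> forall u, `‖T u‖ <= c * `‖u‖.
Proof.
move=> lT Tc u; have [->|/rnorm_gt0 u0] := eqVneq u 0.
  by rewrite linearT_0// rnorm0 mulr0.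
have : `‖T (`‖u‖^-1%:C *: u)‖ <= c.
  by apply: Tc; rewrite rnormZr ger0_norm ?invr_ge0 ?rnorm_ge0// mulVf ?gt_eqF.
by rewrite linearT_Z// rnormZr ger0_norm ?invr_ge0 ?rnorm_ge0// ler_pdivrMl// mulrC.
Qed.

Definition opnorm T : R := sup [set `‖T u‖ | u in [set u : H | `‖u‖ <= 1]].

Lemma opnormP T : bounded_op T -> 0 <= opnorm T /\
  forall u, `‖T u‖ <= opnorm T * `‖u‖.
Proof.
move=> /bounded_opP[lT [M M0 TM]].
have T1 u : `‖u‖ <= 1 -> `‖T u‖ <= opnorm T.
  move=> u1; apply: ub_le_sup; last by exists u.
  exists M => _ [v /= v1 <-]; rewrite (le_trans (TM _))//.
  by rewrite -[leRHS]mulr1 ler_wpM2l.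
split=> [|u].
  by rewrite (le_trans _ (T1 0 _)) ?rnorm_ge0// rnorm0.
exact: unit_ball_bound.
Qed.

Lemma opnorm_adherent T (e : R) : 0 < e ->
  bounded_op T -> exists2 u, `‖u‖ <= 1 & opnorm T - e < `‖T u‖.
Proof.
move=> e0 /bounded_opP[lT [M M0 TM]].
have [|_ [u u1 <-] ue] := @sup_adherent _ [set `‖T u‖ | u in [set u : H | `‖u‖ <= 1]] e e0.
  split; first by exists `‖T 0‖, 0; rewrite //= rnorm0.
  exists M => _ [v /= v1 <-]; rewrite (le_trans (TM _))//.
  by rewrite -[leRHS]mulr1 ler_wpM2l.
by exists u.
Qed.

(** Vectors [u] of norm at most 1 with [`‖T u‖] close to the operator norm [N]
    are approximate eigenvectors of [T ^ 2]:
    [`‖T (T u) - N ^ 2 u‖ ^ 2 <= 2 * N ^ 4 - 2 * N ^ 2 * `‖T u‖ ^ 2]. *)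
Lemma opnorm_sqr_spectrum T : bounded_op T -> symmetric_op T -> 0 < opnorm T ->
  ~ invertible_op (fun u => T (T u) - (opnorm T ^+ 2)%:C *: u).
Proof.
move=> bT sT; have [_ TN] := opnormP bT; move: TN (@opnorm_adherent T).
move: (opnorm T) => N TN ad N0 [S [/bounded_opP[_ [M M0 SM]] ST _]].
have key (e : R) : 0 < e -> e < N -> N - e <= N * M * Num.sqrt (4 * N ^+ 3 * e).
  move=> e0 eN; have [//|u u1 ue] := ad _ e0.
  rewrite (le_trans (ltW ue))// (le_trans (TN _))// -mulrA ler_wpM2l ?(ltW N0)//.
  rewrite -[in leLHS](ST u) (le_trans (SM _))// ler_wpM2l//.
  rewrite -(@ler_pXn2r _ 2) ?nnegrE ?rnorm_ge0 ?sqrtr_ge0// sqr_sqrtr; last first.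
    by rewrite !mulr_ge0 ?exprn_ge0// ltW.
  rewrite rnormB_sq rnormZr dotZr conjc_real Re_mulr sT dotuu /=.
  rewrite ger0_norm ?exprn_ge0 ?(ltW N0)//.
  have h1 : `‖T (T u)‖ ^+ 2 <= N ^+ 4.
    rewrite (exprM N 2 2) ler_pXn2r ?nnegrE ?rnorm_ge0 ?exprn_ge0 ?(ltW N0)//.
    rewrite (le_trans (TN _))// expr2 ler_wpM2l ?(ltW N0)// (le_trans (TN _))//.
    by rewrite -[leRHS]mulr1 ler_wpM2l ?(ltW N0).
  have h2 : (N - e) ^+ 2 <= `‖T u‖ ^+ 2.
    by rewrite ler_pXn2r ?nnegrE ?rnorm_ge0 ?subr_ge0 ?ltW.
  have h3 : `‖u‖ ^+ 2 <= 1 by rewrite expr_le1// rnorm_ge0.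
  have h4 : (N ^+ 2 * `‖u‖) ^+ 2 <= N ^+ 4.
    rewrite exprMn -exprM -[leRHS]mulr1 ler_wpM2l ?exprn_ge0// ltW//.
  have h5 : N ^+ 2 * (N - e) ^+ 2 <= N ^+ 2 * `‖T u‖ ^+ 2.
    by rewrite ler_wpM2l ?exprn_ge0// ltW.
  apply: le_trans (_ : N ^+ 4 + N ^+ 4 - 2 * (N ^+ 2 * (N - e) ^+ 2) <= _).
    by apply: lerB; [exact: lerD|rewrite ler_pM2l].
  have : 0 <= N ^+ 2 * e ^+ 2 by rewrite mulr_ge0 ?exprn_ge0 ?ltW.
  rewrite -subr_ge0; nra.
(* for [e = N * s ^ 2], [key] reads [1 - s ^ 2 <= 2 * M * N ^ 2 * s = 1 - 2 * s] *)
pose s : R := (2 * M * N ^+ 2 + 2)^-1.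
have D2 : 2 <= 2 * M * N ^+ 2 + 2 by rewrite lerDr !mulr_ge0// ltW.
have D0 : 0 < 2 * M * N ^+ 2 + 2 by exact: lt_le_trans D2.
have s0 : 0 < s by rewrite invr_gt0.
have s1 : s < 1 by rewrite invf_lt1// (lt_le_trans _ D2)// ltr1n.
have sD : s * (2 * M * N ^+ 2 + 2) = 1 by rewrite mulVf ?gt_eqF.
have := key (N * s ^+ 2); rewrite (_ : 4 * N ^+ 3 * _ = (2 * N ^+ 2 * s) ^+ 2); last by ring.
rewrite sqrtr_sqr ger0_norm; last by rewrite !mulr_ge0 ?exprn_ge0 ?ltW.
have s21 : s ^+ 2 < 1 by rewrite expr_lt1// ltW.
rewrite mulr_gt0 ?exprn_gt0// gtr_pMr// => /(_ isT s21).
rewrite -{1}[N]mulr1 -mulrBr -[N * M * _]mulrA ler_pM2l// leNgt => /negP; apply.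
have -> : M * (2 * N ^+ 2 * s) = s * (2 * M * N ^+ 2 + 2) - 2 * s by ring.
by rewrite sD ltrD2l ltrN2 expr2 ltr_pM2r// (lt_trans s1)// ltr1n.
Qed.

(** If the norm [N] of [p(A)] is positive, [|p|] takes the value [N] on the
    spectrum: otherwise no root of [p ^ 2 - N ^ 2] is in the spectrum, so that
    [p(A) ^ 2 - N ^ 2] is invertible. *)
Lemma spectral_bound A (p : {poly R}) (c : R) : bounded_op A -> symmetric_op A ->
  0 <= c -> (forall t : R, spectrum A t%:C -> `|p.[t]| <= c) ->
  forall u, `‖horner_op p A u‖ <= c * `‖u‖.
Proof.
move=> bA sA c0.
have lA : linear A by case: bA.
have bp (q : {poly R}) : bounded_op (horner_op q A).
  by rewrite horner_opE; exact: chorner_bounded.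
(* the second hypothesis excludes the constants [q] equal to plus or minus the norm *)
have root_spectrum (q : {poly R}) : 0 < opnorm (horner_op q A) ->
    q ^+ 2 - (opnorm (horner_op q A) ^+ 2)%:P != 0 ->
    exists2 t : R, spectrum A t%:C & `|q.[t]| = opnorm (horner_op q A).
  move=> N0 q0; have sq := horner_op_symmetric q lA sA.
  have := opnorm_sqr_spectrum (bp q) sq N0; move: (opnorm _) N0 q0 => N N0 q0.
  rewrite (_ : (fun _ => _) = chorner (map_poly (real_complex R) (q ^+ 2 - (N ^+ 2)%:P)) A).
    move=> ninv; apply: contrapT => nroot; apply: ninv.
    apply: chorner_invertible => //; first by rewrite map_poly_eq0.
    move=> z qz; apply: contrapT => Az; apply: nroot.
    have zR : z = (complex.Re z)%:C by exact: symmetric_spectrum_real bA sA Az.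
    exists (complex.Re z); first by rewrite -zR.
    move: qz; rewrite zR /root horner_map fmorph_eq0 hornerD hornerN hornerC horner_exp.
    by rewrite subr_eq0 => /eqP E; rewrite -sqrtr_sqr E sqrtr_sqr gtr0_norm.
  have -> : map_poly (real_complex R) (q ^+ 2 - (N ^+ 2)%:P) =
      map_poly (real_complex R) q * map_poly (real_complex R) q + (- (N ^+ 2)%:C)%:P.
    by rewrite (expr2 q) rmorphB rmorphM /= map_polyC polyCN.
  by apply/funext => u; rewrite chornerD chornerM// chornerC !horner_opE scaleNr.
move=> pc u; have [N0 pN] := opnormP (bp p); rewrite (le_trans (pN u))//.
rewrite ler_wpM2r ?rnorm_ge0//.
have [|{}N0] := leP (opnorm (horner_op p A)) 0; first by move/le_trans; apply.
have [q0|/(root_spectrum _ N0)[t At <-]] := eqVneq (p ^+ 2 - (opnorm (horner_op p A) ^+ 2)%:P) 0;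
  last exact: pc.
(* if [p ^ 2] is the constant [N ^ 2], any point of the spectrum will do; there is
   one because [q = 'X] is not constant, or because [A = 0] *)
suff [t At] : exists t : R, spectrum A t%:C.
  rewrite (le_trans _ (pc t At))//.
  have /(congr1 (fun r => r.[t])) := q0.
  rewrite hornerD hornerN hornerC horner_exp horner0 => /eqP; rewrite subr_eq0 => /eqP E.
  by rewrite -sqrtr_sqr E sqrtr_sqr ler_norm.
have XA : horner_op 'X A = A.
  by apply/funext => v; rewrite horner_opE map_polyX chornerX.
have [A0|A0] := leP (opnorm A) 0; last first.
  have [||t At _] := root_spectrum 'X; rewrite ?XA//; last by exists t.
  by rewrite -size_poly_eq0 size_XnsubC.
exists 0 => -[S [[lS _] SA _]].
have z0 v : v = 0.
  rewrite -(SA v) scale0r subr0 (_ : A v = 0) ?linearT_0//.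
  apply: rnorm_le0; have [_ AN] := opnormP bA; rewrite (le_trans (AN v))//.
  by rewrite mulr_le0_ge0 ?rnorm_ge0.
have [v _] := opnorm_adherent N0 (bp p).
by rewrite subrr (z0 (horner_op p A v)) rnorm0 ltxx.
Qed.

End SelfAdjointSpectrum.

(** * Continuous functional calculus *)

Lemma uniform_cvgnP (K : numFieldType) (U : choiceType)
    (V : pseudoMetricNormedZmodType K) (D : set U) (F : nat -> U -> V) (f : U -> V) :
  {uniform D, F @ \oo --> f} <->
  (forall e : K, 0 < e -> exists N, forall n, (N <= n)%N -> forall x, D x -> `|f x - F n x| < e).
Proof.
split=> [Ff e e0|Ff].
  have : nbhs (f : {uniform` D -> V}) [set h | forall x, D x -> `|f x - h x| < e].
    apply/uniform_nbhs; exists [set xy | ball xy.1 e xy.2]; split.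
      exact: (entourage_ball V (PosNum e0)).
    by move=> h /= fh x Dx; have := fh x Dx; rewrite -ball_normE.
  by move=> /Ff[N _ NF]; exists N => n Nn x; apply: NF.
move=> P /uniform_nbhs[E [+ EP]].
rewrite -entourage_ballE => -[e /= e0 eE].
have [N FN] := Ff e e0.
exists N => // n Nn; apply: EP => x Dx; apply: eE => /=.
by rewrite -ball_normE /=; exact: FN.
Qed.

Lemma ler_eps_mul {R : realType} (x y z : R) : 0 <= z ->
  (forall e : R, 0 < e -> x <= y + e * z) -> x <= y.
Proof.
move=> z0 xy; apply: ler_eps => e e0.
have z1 : 0 < z + 1 by rewrite ltr_wpDl.
rewrite (le_trans (xy (e / (z + 1)) _)) ?divr_gt0// lerD2l.
by rewrite mulrAC ler_pdivrMr// ler_wpM2l ?ltW// ltrDl.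
Qed.

Lemma invS_lt {R : realType} (e : R) : 0 < e ->
  exists N, forall n, (N <= n)%N -> n.+1%:R^-1 < e.
Proof.
move=> e0; exists (Num.truncn e^-1) => n Nn.
rewrite -[e]invrK ltf_pV2 ?posrE ?invr_gt0// (lt_le_trans (truncnS_gt _))//.
by rewrite ler_nat ltnS.
Qed.

Section FunctionalCalculus.
Context {R : realType} {X : Type} {H : rkhs R X}.
Implicit Types (u v w : H) (A B C S T : H -> H) (p q : {poly R}) (f g : R -> R).

Lemma horner_op_linear p A : linear A -> linear (horner_op p A).
Proof. by move=> lA; rewrite horner_opE; exact: chorner_linear. Qed.

Lemma horner_op_bounded p A : bounded_op A -> bounded_op (horner_op p A).
Proof. by move=> bA; rewrite horner_opE; exact: chorner_bounded. Qed.

Lemma horner_opB p q A u :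
  horner_op (p - q) A u = horner_op p A u - horner_op q A u.
Proof.
by rewrite !horner_opE rmorphB /= -scaleN1r chornerD chornerZ scaleN1r.
Qed.

Lemma horner_opD p q A u :
  horner_op (p + q) A u = horner_op p A u + horner_op q A u.
Proof. by rewrite !horner_opE rmorphD /= chornerD. Qed.

Lemma horner_opC (c : R) A u : horner_op c%:P A u = c%:C *: u.
Proof. by rewrite horner_opE map_polyC chornerC. Qed.

Lemma horner_opX A u : horner_op 'X A u = A u.
Proof. by rewrite horner_opE map_polyX chornerX. Qed.

Lemma horner_opM p q A u : linear A ->
  horner_op (p * q) A u = horner_op p A (horner_op q A u).
Proof. by move=> lA; rewrite !horner_opE rmorphM /= chornerM. Qed.

(** The two approximations of the functional calculus, the second one as a bound
    for the operator norm. *)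
Definition approximates f A B p (e : R) :=
  (forall t : R, spectrum A t%:C -> `|f t - p.[t]| <= e) /\
  (forall u, `‖B u - horner_op p A u‖ <= e * `‖u‖).

Lemma is_fcalcP f A B : bounded_op A ->
  is_fcalc f A B <-> bounded_op B /\ exists p : nat -> {poly R},
    forall e : R, 0 < e -> exists N, forall n, (N <= n)%N -> approximates f A B (p n) e.
Proof.
move=> bA; have [lA _] := bA; split=> -[bB [p]].
  move=> [/uniform_cvgnP fp /uniform_cvgnP Bp].
  split=> //; exists p => e e0; have [N fN] := fp e e0.
  have [|M BM] := Bp e%:C; first by rewrite ltcR.
  exists (maxn N M) => n; rewrite geq_max => /andP[Nn Mn]; split.
    by move=> t At; exact/ltW/fN.
  apply: unit_ball_bound => [a u v|u u1].
    have [lB _] := bB; rewrite lB (horner_op_linear _ lA) opprD addrACA.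
    by rewrite -scalerBr.
  apply: ltW; rewrite -ltcR -normCE; apply: BM => //=.
  by rewrite normCE -[1]/(1%:C) lecR.
move=> pe; split=> //; exists p; split; apply/uniform_cvgnP.
  move=> e e0; have e20 : 0 < e / 2 by rewrite divr_gt0.
  have [N pN] := pe _ e20; exists N => n /pN[fN _] t At.
  by rewrite (le_lt_trans (fN _ At))// ltr_pdivrMr// ltr_pMr// ltr1n.
move=> _ /gt0_complexP[e e0 ->]; have e20 : 0 < e / 2 by rewrite divr_gt0.
have [N pN] := pe _ e20; exists N => n /pN[_ BN] u /=.
rewrite !normCE -[1]/(1%:C) lecR ltcR => u1.
rewrite (le_lt_trans (BN _))//; move: u1 (rnorm_ge0 u); nra.
Qed.

(** The limit of [spectral_bound] for the difference of approximating polynomials. *)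
Lemma fcalc_dist f g A B C (c : R) : bounded_op A -> symmetric_op A ->
  is_fcalc f A B -> is_fcalc g A C -> 0 <= c ->
  (forall t : R, spectrum A t%:C -> `|f t - g t| <= c) ->
  forall u, `‖B u - C u‖ <= c * `‖u‖.
Proof.
move=> bA sA /(is_fcalcP _ _ bA)[bB [p fp]] /(is_fcalcP _ _ bA)[bC [q gq]] c0 fg u.
apply: (@ler_eps_mul _ _ _ (4 * `‖u‖)) => [|e e0].
  by rewrite mulr_ge0 ?rnorm_ge0.
have [N pN] := fp _ e0; have [M qM] := gq _ e0.
have [fN BN] := pN _ (leq_maxl N M); have [gM CM] := qM _ (leq_maxr N M).
move: (p _) (q _) fN BN gM CM => {p q pN qM fp gq} p q fN BN gM CM.
have pq : `‖horner_op (p - q) A u‖ <= (c + 2 * e) * `‖u‖.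
  apply: spectral_bound => // [|t At]; first by rewrite addr_ge0// mulr_ge0// ltW.
  rewrite hornerD hornerN; move: (fN _ At) (gM _ At) (fg _ At).
  by rewrite !ler_norml => /andP[? ?] /andP[? ?] /andP[? ?]; apply/andP; split; lra.
move: pq (BN u) (CM u) (vdistD (horner_op p A u) (B u) (C u)).
move: (vdistD (horner_op q A u) (horner_op p A u) (C u)).
rewrite horner_opB (vdistC (horner_op q A u) (C u)); lra.
Qed.

Lemma fcalc_unique f g A B C : bounded_op A -> symmetric_op A ->
  is_fcalc f A B -> is_fcalc g A C ->
  (forall t : R, spectrum A t%:C -> f t = g t) -> B = C.
Proof.
move=> bA sA fB gC fg; apply/funext => u; apply: rdist_le0.
rewrite (le_trans (fcalc_dist bA sA fB gC (lexx 0) _ u)) ?mul0r//.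
by move=> t /fg ->; rewrite subrr normr0.
Qed.

Lemma fcalc_poly p A : bounded_op A ->
  is_fcalc (fun t => p.[t]) A (horner_op p A).
Proof.
move=> bA; apply/is_fcalcP => //; split; first exact: horner_op_bounded.
exists (fun=> p) => e e0; exists 0%N => n _; split=> [t _|u].
  by rewrite subrr normr0 ltW.
by rewrite subrr rnorm0 mulr_ge0 ?rnorm_ge0// ltW.
Qed.

Lemma fcalc_symmetric f A B : bounded_op A -> symmetric_op A ->
  is_fcalc f A B -> symmetric_op B.
Proof.
move=> bA sA /(is_fcalcP _ _ bA)[bB [p fp]] u v; have [lA _] := bA.
apply: rdist_le0; apply: (@ler_eps_mul _ _ _ (2 * (`‖u‖ * `‖v‖))) => [|e e0].
  by rewrite !mulr_ge0 ?rnorm_ge0.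
have [N pN] := fp _ e0; have [_ BN] := pN _ (leqnn N).
have -> : ⟨B u, v⟩ - ⟨u, B v⟩ =
    ⟨B u - horner_op (p N) A u, v⟩ - ⟨u, B v - horner_op (p N) A v⟩.
  by rewrite dotBl dotBr horner_op_symmetric// opprB addrA subrK.
rewrite add0r (le_trans (rnormD _ _))// rnormN.
have := cauchy_schwarz (B u - horner_op (p N) A u) v.
have := cauchy_schwarz u (B v - horner_op (p N) A v).
move: (BN u) (BN v) (rnorm_ge0 u) (rnorm_ge0 v) => h1 h2 u0 v0 h3 h4.
have := ler_wpM2l u0 h2; have := ler_wpM2r v0 h1.
move: h3 h4; set a := `‖_‖; set b := `‖_‖; lra.
Qed.

Lemma fcalc_mul f g A B C (F G : R) : bounded_op A -> symmetric_op A ->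
  is_fcalc f A B -> is_fcalc g A C ->
  (forall t : R, spectrum A t%:C -> `|f t| <= F) ->
  (forall t : R, spectrum A t%:C -> `|g t| <= G) ->
  is_fcalc (fun t => f t * g t) A (B \o C).
Proof.
move=> bA sA /(is_fcalcP _ _ bA)[bB [p fp]] /(is_fcalcP _ _ bA)[bC [q gq]] fF gG.
have [lA _] := bA; have [lB [M M0 BM]] := bounded_opP bB.
have [lC [L L0 CL]] := bounded_opP bC.
apply/is_fcalcP => //; split; first exact: bounded_comp.
exists (fun n => p n * q n) => e e0.
(* [K] dominates the factors of [d] in both estimates, and [d <= 1], [d * K <= e] *)
pose K : R := `|F| + `|G| + M + L + 2.
have K0 : 0 < K by rewrite ltr_wpDl// !addr_ge0.
pose d := e / (K + e); have Ke : 0 < K + e by rewrite addr_gt0.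
have d0 : 0 < d by rewrite divr_gt0.
have d1 : d <= 1 by rewrite ler_pdivrMr// mul1r lerDr ltW.
have dK : d * K <= e by rewrite mulrAC ler_pdivrMr// ler_pM2l// lerDl ltW.
clearbody d; have [N1 pN] := fp _ d0; have [N2 qN] := gq _ d0.
exists (maxn N1 N2) => n; rewrite geq_max => /andP[/pN[fN BN] /qN[gN CN]].
split=> [t At|u].
  rewrite hornerM; have -> : f t * g t - (p n).[t] * (q n).[t] =
    f t * (g t - (q n).[t]) + (f t - (p n).[t]) * (q n).[t] by ring.
  have q1 : `|(q n).[t]| <= `|G| + d.
    rewrite -[X in `|X|](subKr (g t)) (le_trans (ler_normB _ _))// lerD ?gN//.
    by rewrite (le_trans (gG _ At))// ler_norm.
  have f1 : `|f t| <= `|F| by rewrite (le_trans (fF _ At))// ler_norm.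
  rewrite (le_trans (ler_normD _ _))// !normrM.
  have := ler_pM (normr_ge0 _) (normr_ge0 _) f1 (gN _ At).
  have := ler_pM (normr_ge0 _) (normr_ge0 _) (fN _ At) q1.
  have := ler_wpM2l (ltW d0) d1.
  have := mulr_ge0 (ltW d0) M0; have := mulr_ge0 (ltW d0) L0.
  move: dK; rewrite /K; lra.
rewrite horner_opM//=; set v := horner_op (q n) A u.
have v1 : `‖v‖ <= (L + 1) * `‖u‖.
  have := vdistD (C u) 0 v; rewrite !sub0r !rnormN => /le_trans; apply.
  rewrite mulrDl lerD// (le_trans (CN u))// ler_wpM2r ?rnorm_ge0//.
rewrite (le_trans (vdistD (B v) _ _))// -(linearT_B _ _ lB).
have := le_trans (BM (C u - v)) (ler_wpM2l M0 (CN u)).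
have := le_trans (BN v) (ler_wpM2l (ltW d0) v1).
have : 0 <= d * `‖u‖ * (`|F| + `|G| + 1).
  by rewrite !mulr_ge0 ?rnorm_ge0 ?(ltW d0)// !addr_ge0.
have := ler_wpM2r (rnorm_ge0 u) dK; rewrite /K.
move: (`‖B v - horner_op (p n) A v‖) (`‖B (C u - v)‖) `‖u‖ `|F| `|G| => a b n1 F1 G1; lra.
Qed.

(** If [f] lies between [p] and [p + K] on the spectrum, it is within [K / 2] of
    the polynomial [p + K / 2]. *)
Lemma fcalc_ge_poly f p A B (K : R) : bounded_op A -> symmetric_op A ->
  is_fcalc f A B -> 0 <= K ->
  (forall t : R, spectrum A t%:C -> p.[t] <= f t <= p.[t] + K) ->
  forall u, complex.Re ⟨horner_op p A u, u⟩ <= complex.Re ⟨B u, u⟩.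
Proof.
move=> bA sA fB K0 pf u; pose q := p + (K / 2)%:P.
have K2 : 0 <= K / 2 by rewrite divr_ge0.
have d : `‖horner_op q A u - B u‖ <= K / 2 * `‖u‖.
  apply: (fcalc_dist bA sA (fcalc_poly q bA) fB) => // t /pf/andP[h1 h2].
  by rewrite hornerD hornerC ler_norml; apply/andP; split; lra.
have : complex.Re ⟨horner_op q A u - B u, u⟩ <= K / 2 * `‖u‖ * `‖u‖.
  rewrite (le_trans (le_Re_rnorm _))// (le_trans (cauchy_schwarz _ _))//.
  by rewrite ler_wpM2r ?rnorm_ge0.
rewrite dotBl horner_opD horner_opC dotDl dotZl dotuu ReB ReD Re_mulr /=; lra.
Qed.

(** By [spectral_bound], polynomials that converge uniformly on the spectrum give
    operators that converge in norm. *)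
Lemma fcalcP f A : bounded_op A -> symmetric_op A ->
  (forall e : R, 0 < e -> exists p : {poly R},
    forall t : R, spectrum A t%:C -> `|f t - p.[t]| <= e) ->
  is_fcalc f A (fcalc f A).
Proof.
move=> bA sA fp; apply: (@xgetPex _ (fun=> 0) [set B | is_fcalc f A B]).
have [lA _] := bA; pose s n : R := n.+1%:R^-1.
have s0 n : 0 < s n by rewrite invr_gt0.
have /choice[p pP] n : exists p : {poly R},
    forall t : R, spectrum A t%:C -> `|f t - p.[t]| <= s n by exact: fp.
have pd m n u : `‖horner_op (p n) A u - horner_op (p m) A u‖ <= (s n + s m) * `‖u‖.
  rewrite -horner_opB; apply: spectral_bound => // [|t At].
    by rewrite addr_ge0// ltW.
  rewrite hornerD hornerN -[_ - _](subrKA (f t)) (le_trans (ler_normD _ _))//.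
  by rewrite lerD ?pP// distrC pP.
have /choice[B BP] u : exists l : H, (fun n => horner_op (p n) A u) @ \oo --> l.
  apply: rkhs_complete => e e0.
  have [|N sN] := invS_lt (e := e / (2 * (`‖u‖ + 1))).
    by rewrite divr_gt0// mulr_gt0// ltr_wpDl ?rnorm_ge0.
  exists N => n Nn; rewrite (le_lt_trans (pd _ _ _))//.
  have := sN _ Nn; have := sN _ (leqnn N); rewrite -/(s _) -/(s _).
  have u1 : 0 < `‖u‖ + 1 by rewrite ltr_wpDl ?rnorm_ge0.
  rewrite !ltr_pdivlMr ?mulr_gt0//; move: (s0 n) (s0 N); lra.
have BpE n u : `‖B u - horner_op (p n) A u‖ <= 2 * s n * `‖u‖.
  apply: ler_eps => e e0; have [N BN] := (cvgnP _ _).1 (BP u) _ e0.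
  have := BN _ (leq_maxl N n); have := pd n (maxn N n) u.
  have : s (maxn N n) <= s n by rewrite lef_pV2 ?posrE// ler_nat ltnS leq_maxr.
  move=> /(ler_wpM2r (rnorm_ge0 u)).
  have := vdistD (horner_op (p (maxn N n)) A u) (B u) (horner_op (p n) A u); lra.
have lB : linear B.
  move=> a u v; apply: rdist_le0.
  pose K := 2 * (`‖a *: u + v‖ + `‖a‖ * `‖u‖ + `‖v‖).
  apply: (@ler_eps_mul _ _ _ K) => [|e e0]; first by rewrite mulr_ge0// !addr_ge0// ?mulr_ge0// rnorm_ge0.
  have [N /(_ N (leqnn N))] := invS_lt e0; rewrite -/(s N) => sN.
  pose T := horner_op (p N) A.
  have -> : B (a *: u + v) - (a *: B u + B v) =
      (B (a *: u + v) - T (a *: u + v)) - (a *: (B u - T u) + (B v - T v)).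
    rewrite /T (horner_op_linear (p N) lA) scalerBr addrACA -opprD opprB.
    by rewrite addrA subrK.
  have D w : `‖B w - T w‖ <= 2 * e * `‖w‖.
    by rewrite (le_trans (BpE N w))// ler_wpM2r ?rnorm_ge0// ler_pM2l// ltW.
  rewrite add0r (le_trans (rnormD _ _))// rnormN.
  rewrite (_ : e * K = 2 * e * `‖a *: u + v‖ + (`‖a‖ * (2 * e * `‖u‖) + 2 * e * `‖v‖)).
    rewrite lerD// (le_trans (vnormD _ _))// lerD// rnormZ.
    by rewrite ler_wpM2l ?rnorm_ge0.
  by rewrite /K; ring.
exists B; apply/is_fcalcP => //; split.
  have [_ [M M0 TM]] := bounded_opP (horner_op_bounded (p 0%N) bA).
  apply: (@bounded_opI _ _ _ _ (2 * s 0%N + M)) => // u.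
  rewrite -[B u](subrK (horner_op (p 0%N) A u)) mulrDl.
  by rewrite (le_trans (vnormD _ _))// lerD.
exists p => e e0; have [|N sN] := invS_lt (e := e / 2); first by rewrite divr_gt0.
exists N => n /sN; rewrite -/(s n) => sne; split=> [t At|u].
  rewrite (le_trans (pP n t At))// (le_trans (ltW sne))//; lra.
by rewrite (le_trans (BpE n u))// ler_wpM2r ?rnorm_ge0// mulrC -ler_pdivlMr// ltW.
Qed.

End FunctionalCalculus.

(** * Weierstrass approximation, and real powers *)

Section Approximation.
Context {R : realType}.
Implicit Types (g h : nat -> R) (f : R -> R) (x y a c d e M : R).

(** The Bernstein polynomial of [g], as the expectation of [g] at a sum of [n]
    independent Bernoulli variables of parameter ['X]; the recursion
    conditions on one of them. *)
Fixpoint bernstein n g : {poly R} :=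
  if n is m.+1 then
    'X * bernstein m (fun k => g k.+1) + (1 - 'X) * bernstein m g
  else (g 0%N)%:P.

Lemma bernstein_le n g h x : 0 <= x <= 1 ->
  (forall k, (k <= n)%N -> g k <= h k) -> (bernstein n g).[x] <= (bernstein n h).[x].
Proof.
move=> /andP[x0 x1]; elim: n g h => [|n IH] g h gh.
  by rewrite /= !hornerC gh.
rewrite /= !hornerE lerD//; apply: ler_wpM2l; rewrite ?subr_ge0//; apply: IH => k kn.
  exact: gh.
by apply: gh; rewrite (leq_trans kn).
Qed.

(** The second moment about [a]; the variance is [n x (1 - x)]. *)
Lemma bernstein_sqr n c d a x :
  (bernstein n (fun k => c + d * (k%:R - a) ^+ 2)).[x] =
  c + d * (n%:R * x * (1 - x) + (n%:R * x - a) ^+ 2).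
Proof.
elim: n a => [|n IH] a; first by rewrite /= hornerC; ring.
rewrite /= !hornerE IH.
have -> : (fun k => c + d * (k.+1%:R - a) ^+ 2) =
    (fun k => c + d * (k%:R - (a - 1)) ^+ 2) :> (nat -> R).
  by apply/funext => k; rewrite -natr1; ring.
by rewrite IH -natr1; ring.
Qed.

(** Uniform continuity on [[0, M]] for a bounded function, in the form that the
    variance of a Bernoulli sum controls. *)
Definition quadratic_modulus M f := forall e, 0 < e -> exists2 C, 0 <= C &
  forall x y, 0 <= x <= M -> 0 <= y <= M -> `|f x - f y| <= e + C * (x - y) ^+ 2.

(** Bernstein's proof: after rescaling to [[0, 1]], the error at [x] is at most the
    expectation of the modulus, and the variance is of order [1 / n]. *)
Lemma weierstrass M f : 0 < M -> quadratic_modulus M f ->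
  forall e, 0 < e -> exists p : {poly R}, forall t, 0 <= t <= M -> `|f t - p.[t]| <= e.
Proof.
move=> M0 fM e e0; have e20 : 0 < e / 2 by rewrite divr_gt0.
have [C C0 fC] := fM _ e20.
pose n := (Num.truncn (2 * C * M ^+ 2 / e)).+1.
have n0 : 0 < n%:R :> R by rewrite ltr0n.
have nC : 2 * C * M ^+ 2 < e * n%:R.
  by rewrite -ltr_pdivrMl// [_^-1 * _]mulrC truncnS_gt.
pose g k := f (M * (k%:R / n%:R)).
exists (bernstein n g \Po (M^-1 *: 'X)) => t /andP[t0 tM].
rewrite horner_comp hornerZ hornerX; set x := M^-1 * t.
have x01 : 0 <= x <= 1 by rewrite /x mulr_ge0 ?invr_ge0 ?(ltW M0)//= ler_pdivrMl// mulr1.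
have tE : t = M * x by rewrite /x mulrA mulfV ?gt_eqF// mul1r.
pose D := C * M ^+ 2 / n%:R ^+ 2.
have gk k : (k <= n)%N -> `|f t - g k| <= e / 2 + D * (k%:R - n%:R * x) ^+ 2.
  move=> kn; rewrite (le_trans (fC _ _ _ _)) ?t0 ?tM//.
    rewrite mulr_ge0 ?divr_ge0 ?(ltW M0)//= ger_pMr// ler_pdivrMr// mul1r.
    by rewrite ler_nat.
  rewrite lerD2l /D tE le_eqVlt; apply/orP; left; apply/eqP.
  by field; rewrite gt_eqF.
have De : D * (n%:R * x * (1 - x) + (n%:R * x - n%:R * x) ^+ 2) <= e / 2.
  rewrite subrr expr0n addr0.
  have -> : D * (n%:R * x * (1 - x)) = C * M ^+ 2 / n%:R * (x * (1 - x)).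
    by rewrite /D; field; rewrite gt_eqF.
  have xx : x * (1 - x) <= 1.
    by move: x01 => /andP[? ?]; rewrite mulr_ile1 ?subr_ge0// lerBlDr lerDl.
  rewrite (@le_trans _ _ (C * M ^+ 2 / n%:R))//.
    by rewrite ler_piMr// !mulr_ge0 ?invr_ge0// ltW.
  by rewrite ler_pdivrMr//; move: nC; lra.
clearbody g D x n; have ub := bernstein_le x01 (h := fun k => (f t + e / 2) + D * (k%:R - n%:R * x) ^+ 2) (g := g) (n := n).
have lb := bernstein_le x01 (g := fun k => (f t - e / 2) + (- D) * (k%:R - n%:R * x) ^+ 2) (h := g) (n := n).
rewrite !bernstein_sqr in ub lb.
rewrite ler_norml; apply/andP; split.
  have /ub : forall k, (k <= n)%N -> g k <= f t + e / 2 + D * (k%:R - n%:R * x) ^+ 2.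
    by move=> k /gk; rewrite ler_norml => /andP[]; lra.
  by move: De; lra.
have /lb : forall k, (k <= n)%N -> f t - e / 2 + - D * (k%:R - n%:R * x) ^+ 2 <= g k.
  by move=> k /gk; rewrite ler_norml => /andP[]; lra.
by move: De; lra.
Qed.

Lemma lipschitz_quadratic_modulus M f (L : R) :
  (forall x y, 0 <= x <= M -> 0 <= y <= M -> `|f x - f y| <= L * `|x - y|) ->
  quadratic_modulus M f.
Proof.
move=> fL e e0; exists (L ^+ 2 / (4 * e)) => [|x y xM yM].
  by rewrite divr_ge0 ?sqr_ge0// mulr_ge0// ltW.
rewrite (le_trans (fL _ _ xM yM))// -subr_ge0 -(real_normK (num_real (x - y))).
have -> : e + L ^+ 2 / (4 * e) * `|x - y| ^+ 2 - L * `|x - y| =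
   (2 * e - L * `|x - y|) ^+ 2 / (4 * e) by field; rewrite gt_eqF.
by rewrite divr_ge0 ?sqr_ge0// mulr_ge0// ltW.
Qed.

(** The square root is 1/2-Hölder. *)
Lemma sqrt_quadratic_modulus M : quadratic_modulus M Num.sqrt.
Proof.
move=> e e0; exists (e ^- 3) => [|x y /andP[x0 _] /andP[y0 _]].
  by rewrite invr_ge0 exprn_ge0// ltW.
set a := `|_|; have a0 : 0 <= a by exact: normr_ge0.
have aD : a ^+ 2 <= `|x - y|.
  rewrite -[x in leRHS]sqr_sqrtr// -[y in leRHS]sqr_sqrtr// subr_sqr normrM expr2.
  rewrite ler_wpM2l// ger0_norm ?addr_ge0 ?sqrtr_ge0// ler_norml.
  by have := sqrtr_ge0 x; have := sqrtr_ge0 y; move=> *; apply/andP; split; lra.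
have a4 : a ^+ 4 <= (x - y) ^+ 2.
  by rewrite -(real_normK (num_real (x - y))) (exprM a 2 2) ler_pXn2r ?nnegrE ?sqr_ge0.
have [ae|ea] := leP a e.
  by rewrite (le_trans ae)// lerDl mulr_ge0 ?sqr_ge0// invr_ge0 exprn_ge0// ltW.
rewrite (@le_trans _ _ (e ^- 3 * a ^+ 4))//.
  rewrite ler_pdivlMl ?exprn_gt0// [leRHS]exprSr ler_wpM2r//.
  by rewrite ler_pXn2r ?nnegrE// ltW.
by rewrite -[leLHS]add0r lerD ?(ltW e0)// ler_wpM2l// invr_ge0 exprn_ge0// ltW.
Qed.

(** A convex function lies above its tangents; here by Young's inequality. *)
Lemma powR_tangent (s : R) c t : 1 <= s -> 0 < c -> 0 <= t ->
  c `^ s + s * c `^ (s - 1) * (t - c) <= t `^ s.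
Proof.
move=> s1 c0 t0; have s0 : 0 < s by exact: lt_le_trans s1.
have cs : c `^ s = c `^ (s - 1) * c.
  by rewrite -{3}[c]powRr1 ?(ltW c0)// -powRD ?subrK// gt_eqF ?implybT.
have [->|s_neq1] := eqVneq s 1.
  by rewrite subrr powRr0 !powRr1 ?(ltW c0)// !mul1r addrC subrK.
have sm1 : 0 < s - 1 by rewrite subr_gt0 lt_neqAle eq_sym s_neq1.
have := @conjugate_powR R t (c `^ (s - 1)) s (s / (s - 1)) t0 (powR_ge0 _ _) s0.
rewrite divr_gt0// => /(_ isT); rewrite invf_div -powRrM.
have -> : (s - 1) * (s / (s - 1)) = s by field; rewrite gt_eqF.
have -> : s^-1 + (s - 1) / s = 1 by field; rewrite gt_eqF.
move=> /(_ erefl) young.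
have : s * (t * c `^ (s - 1)) <= t `^ s + (s - 1) * c `^ s.
  rewrite -ler_pdivlMl// (le_trans young)// le_eqVlt; apply/orP; left; apply/eqP.
  by field; rewrite !gt_eqF.
by rewrite cs; lra.
Qed.

Lemma powR_lipschitz (s : R) M x y : 1 <= s -> 0 <= x <= M -> 0 <= y <= M ->
  `|x `^ s - y `^ s| <= s * M `^ (s - 1) * `|x - y|.
Proof.
move=> s1; wlog yx : x y / y <= x => [hw xM yM|].
  have [yx|/ltW xy] := leP y x; first exact: hw.
  by rewrite distrC [`|x - y|]distrC; exact: hw.
move=> /andP[x0 xM] /andP[y0 _]; have s0 : 0 <= s by exact: le_trans s1.
rewrite !ger0_norm ?subr_ge0//; last first.
  by apply: ge0_ler_powR; rewrite ?nnegrE.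
have [x_eq0|xn0] := eqVneq x 0.
  have -> : y = x by apply/le_anti; rewrite yx x_eq0.
  by rewrite !subrr mulr0.
have xp : 0 < x by rewrite lt_neqAle eq_sym xn0.
have := powR_tangent s1 xp y0.
have : s * x `^ (s - 1) * (x - y) <= s * M `^ (s - 1) * (x - y).
  rewrite ler_wpM2r ?subr_ge0// ler_wpM2l//.
  by apply: ge0_ler_powR; rewrite ?nnegrE ?subr_ge0// (le_trans x0).
by lra.
Qed.

Lemma powR_quadratic_modulus (s : R) M : 1 <= s -> quadratic_modulus M (fun t => t `^ s).
Proof.
by move=> s1; apply: lipschitz_quadratic_modulus => x y; exact: powR_lipschitz.
Qed.

End Approximation.

(** * Powers of positive operators *)

Section PositiveOperators.
Context {R : realType} {X : Type} {H : rkhs R X}.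
Implicit Types (u v w : H) (A B C S T P Z : H -> H) (f g : R -> R).

Definition positive_op A := forall u : H, 0 <= complex.Re ⟨A u, u⟩.

Lemma spectrum_itv A : bounded_op A -> symmetric_op A -> positive_op A ->
  exists2 M : R, 0 < M & forall t : R, spectrum A t%:C -> 0 <= t <= M.
Proof.
move=> bA sA A0; have [_ [M M0 AM]] := bounded_opP bA.
exists (M + 1) => [|t At]; first by rewrite ltr_wpDl.
rewrite (nonneg_spectrum bA sA A0 At) (le_trans (ler_norm t))//.
by rewrite (le_trans (bounded_spectrum bA sA AM At))// lerDl.
Qed.

Lemma positive_fcalcP f A : bounded_op A -> symmetric_op A -> positive_op A ->
  (forall M : R, quadratic_modulus M f) -> is_fcalc f A (fcalc f A).
Proof.
move=> bA sA A0 fM; have [M M0 AM] := spectrum_itv bA sA A0.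
apply: fcalcP => // e e0; have [p fp] := weierstrass M0 (fM M) e0.
by exists p => t /AM /fp.
Qed.

Lemma fcalc_eq f g A B : bounded_op A -> is_fcalc f A B ->
  (forall t : R, spectrum A t%:C -> f t = g t) -> is_fcalc g A B.
Proof.
move=> bA /(is_fcalcP _ _ bA)[bB [p fp]] fg; apply/is_fcalcP => //; split=> //.
exists p => e /fp[N pN]; exists N => n /pN[fN BN]; split=> // t At.
by rewrite -fg// fN.
Qed.

Lemma fcalc_positive f A B (K : R) : bounded_op A -> symmetric_op A ->
  is_fcalc f A B -> 0 <= K -> (forall t : R, spectrum A t%:C -> 0 <= f t <= K) ->
  positive_op B.
Proof.
move=> bA sA fB K0 f0 u.
have := @fcalc_ge_poly _ _ _ f 0 A B K bA sA fB K0 _ u.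
rewrite -polyC0 horner_opC scale0r dot0l /=; apply => t /f0.
by rewrite hornerC add0r.
Qed.

Lemma op_abs_spec Z : bounded_op Z ->
  [/\ bounded_op (op_abs Z), symmetric_op (op_abs Z), positive_op (op_abs Z) &
      forall u, op_abs Z (op_abs Z u) = adj Z (Z u)].
Proof.
move=> bZ; have [baZ Zadj] := adjP bZ.
have adjZ u v : ⟨adj Z u, v⟩ = ⟨u, Z v⟩ by rewrite dotC -Zadj -dotC.
have bA := bounded_comp baZ bZ.
have sA : symmetric_op (adj Z \o Z) by move=> u v /=; rewrite adjZ Zadj.
have A0 : positive_op (adj Z \o Z).
  by move=> u /=; rewrite adjZ dotuu /= exprn_ge0 ?rnorm_ge0.
have fB := positive_fcalcP bA sA A0 (@sqrt_quadratic_modulus R).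
have [M M0 AM] := spectrum_itv bA sA A0.
have sqrtM (t : R) : spectrum (adj Z \o Z) t%:C -> 0 <= Num.sqrt t <= Num.sqrt M.
  by move=> /AM/andP[t0 tM]; rewrite sqrtr_ge0 ler_wsqrtr.
have sqrtM' (t : R) : spectrum (adj Z \o Z) t%:C -> `|Num.sqrt t| <= Num.sqrt M.
  by move=> /sqrtM/andP[t0 tM]; rewrite ger0_norm.
split.
- by have /(is_fcalcP _ _ bA)[] := fB.
- exact: fcalc_symmetric fB.
- exact: fcalc_positive bA sA fB (sqrtr_ge0 M) sqrtM.
have fBB := fcalc_mul bA sA fB fB sqrtM' sqrtM'.
have := fcalc_unique bA sA fBB (fcalc_poly 'X bA) => E u.
rewrite -[LHS]/((op_abs Z \o op_abs Z) u) E ?horner_opX// => t /AM/andP[t0 _].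
by rewrite hornerX -expr2 sqr_sqrtr.
Qed.

Lemma op_powP A (s : R) : bounded_op A -> symmetric_op A -> positive_op A ->
  1 <= s -> is_fcalc (fun t => t `^ s) A (op_pow A s).
Proof.
move=> bA sA A0 s1; apply: positive_fcalcP => // M; exact: powR_quadratic_modulus.
Qed.

Lemma op_pow_add A (s t : R) : bounded_op A -> symmetric_op A -> positive_op A ->
  1 <= s -> 1 <= t -> op_pow A s \o op_pow A t = op_pow A (s + t).
Proof.
move=> bA sA A0 s1 t1; have [M M0 AM] := spectrum_itv bA sA A0.
have st1 : 1 <= s + t by rewrite (le_trans s1)// lerDl (le_trans _ t1).
have bnd (q : R) : 1 <= q -> forall x : R, spectrum A x%:C -> `|x `^ q| <= M `^ q.
  move=> q1 x /AM/andP[x0 xM]; rewrite ger0_norm ?powR_ge0//.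
  by apply: ge0_ler_powR; rewrite ?nnegrE ?(le_trans _ q1)// ltW.
have fs := op_powP bA sA A0 s1; have ft := op_powP bA sA A0 t1.
apply: (fcalc_unique bA sA (fcalc_mul bA sA fs ft (bnd _ s1) (bnd _ t1)) (op_powP bA sA A0 st1)).
move=> x _; rewrite powRD//; apply/implyP => /eqP st0.
by move: st1; rewrite st0 ler10.
Qed.

(** The Hölder-McCarthy inequality: the tangent to [y |-> y `^ r] at
    [c = <A ^ 2 u, u>], composed with the square, is a polynomial below
    [t `^ (2 * r)], with equality of the quadratic forms at [u]. *)
Lemma hoelder_mccarthy A (r : R) u : bounded_op A -> symmetric_op A ->
  positive_op A -> 1 <= r -> `‖u‖ = 1 ->
  (`‖A u‖ ^+ 2) `^ r <= complex.Re ⟨op_pow A (2 * r) u, u⟩.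
Proof.
move=> bA sA A0 r1 u1; have [M M0 AM] := spectrum_itv bA sA A0.
have r0 : 0 <= r by exact: le_trans r1.
have r21 : 1 <= 2 * r by lra.
have fB := op_powP bA sA A0 r21.
have powM (t : R) : spectrum A t%:C -> 0 <= t `^ (2 * r) <= M `^ (2 * r).
  move=> /AM/andP[t0 tM]; rewrite powR_ge0/=.
  by apply: ge0_ler_powR; rewrite ?nnegrE ?mulr_ge0// ltW.
set c := `‖A u‖ ^+ 2; have c0 : 0 <= c by rewrite exprn_ge0 ?rnorm_ge0.
have [->|cn0] := eqVneq c 0.
  rewrite powR0 ?gt_eqF ?(lt_le_trans _ r1)//.
  exact: fcalc_positive bA sA fB (powR_ge0 _ _) powM u.
have {c0} cp : 0 < c by rewrite lt_neqAle eq_sym cn0.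
pose a := r * c `^ (r - 1); pose b := c `^ r - a * c.
have a0 : 0 <= a by rewrite mulr_ge0 ?powR_ge0.
pose p : {poly R} := a%:P * ('X * 'X) + b%:P.
have pE t : p.[t] = a * (t * t) + b by rewrite !hornerE.
have [lA _] := bA.
have -> : c `^ r = complex.Re ⟨horner_op p A u, u⟩.
  rewrite horner_opD !horner_opM// !horner_opC !horner_opX dotDl !dotZl sA !dotuu.
  rewrite ReD !Re_mulr /= u1 expr1n mulr1 -/c /b; ring.
(* on the spectrum [p >= - a * c], while the power is at most [M `^ (2 * r)] *)
apply: (fcalc_ge_poly bA sA fB (K := M `^ (2 * r) + a * c)).
  by rewrite addr_ge0 ?powR_ge0// mulr_ge0// ltW.
move=> t At; have /andP[_ tM] := powM t At; have /andP[t0 _] := AM t At.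
rewrite pE; apply/andP; split.
  (* [t `^ (2 * r)] is [(t ^ 2) `^ r] *)
  have := powR_tangent r1 cp (mulr_ge0 t0 t0).
  rewrite -expr2 -powR_mulrn// -powRrM; rewrite powR_mulrn// expr2 /b /a; lra.
have := mulr_ge0 a0 (mulr_ge0 t0 t0); have := powR_ge0 c r.
by move: tM; rewrite /b; lra.
Qed.

(** The spectrum of a projection lies in [{0, 1}], where [t `^ s = t]. *)
Lemma op_pow_projection P (s : R) : bounded_op P -> symmetric_op P ->
  (forall u, P (P u) = P u) -> 0 < s -> op_pow P s = P.
Proof.
move=> bP sP PP s0; have [lP _] := bP.
have spec (t : R) : spectrum P t%:C -> t `^ s = t.
  move=> Pt; have [->|t0] := eqVneq t 0; first by rewrite powR0 ?gt_eqF.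
  have [->|t1] := eqVneq t 1; first by rewrite powR1.
  have t10 : 1 - t != 0 by rewrite subr_eq0 eq_sym.
  (* the resolvent, which is a linear combination of [P] and the identity *)
  pose S u := (t * (1 - t))^-1%:C *: P u + (- t^-1)%:C *: u.
  have e1 : (t * (1 - t))^-1%:C * (1 - t)%:C + (- t^-1)%:C = 0 :> R[i].
    by rewrite -rmorphM -rmorphD -[RHS](rmorph0 (real_complex R)); congr _%:C; field; rewrite t0.
  have e2 : (- t^-1)%:C * (- t)%:C = 1 :> R[i].
    by rewrite -rmorphM -[RHS](rmorph1 (real_complex R)); congr _%:C; field.
  have key u : (t * (1 - t))^-1%:C *: ((1 - t)%:C *: P u) + (- t^-1)%:C *: (P u - t%:C *: u) = u.
    rewrite scalerBr scalerA addrA -scalerDl e1 scale0r add0r.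
    by rewrite scalerA -scaleNr -mulrN -rmorphN e2 scale1r.
  have PB u : P (P u - t%:C *: u) = (1 - t)%:C *: P u.
    by rewrite (linearT_B _ _ lP) PP (linearT_Z _ _ lP) rmorphB rmorph1 scalerBl scale1r.
  have bS : bounded_op S by apply: bounded_lin => //; exact: bounded_scale.
  have SK u : S (P u - t%:C *: u) = u by rewrite /S PB key.
  case: Pt; exists S; split=> // u; have [lS _] := bS.
  have -> : P (S u) = S (P u).
    by rewrite /S (linearT_D _ _ lP) !(linearT_Z _ _ lP).
  by rewrite -(linearT_Z _ _ lS) -(linearT_B _ _ lS) SK.
have fP : is_fcalc (fun t => t `^ s) P P.
  have := fcalc_poly 'X bP; rewrite (_ : horner_op 'X P = P); last first.
    by apply/funext => u; rewrite horner_opX.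
  by move/fcalc_eq; apply => // t /spec ->; rewrite hornerX.
apply: (fcalc_unique bP sP _ fP) => //.
by apply: (@xgetPex _ (fun=> 0) [set B | is_fcalc (fun t => t `^ s) P B]); exists P.
Qed.

(** Buzano's inequality: the reflection [2 <a, k> k - a] has the norm of [a]. *)
Lemma buzano (a b k : H) : `‖k‖ = 1 ->
  `‖⟨a, k⟩ * ⟨k, b⟩‖ <= 2^-1 * (`‖a‖ * `‖b‖ + `‖⟨a, b⟩‖).
Proof.
move=> k1; pose w := (2%:C * ⟨a, k⟩) *: k - a.
have nw : `‖w‖ = `‖a‖.
  apply/eqP; rewrite -(@eqrXn2 _ 2)// ?rnorm_ge0//; apply/eqP.
  have E : ⟨(2%:C * ⟨a, k⟩) *: k, a⟩ = (2 * `‖⟨a, k⟩‖ ^+ 2)%:C.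
    by rewrite dotZl (dotC k a) -mulrA rnorm_sq -rmorphM.
  by rewrite rnormB_sq E rnormZ rnormM rnorm_real k1 ger0_norm//=; ring.
have : ⟨w, b⟩ = 2%:C * (⟨a, k⟩ * ⟨k, b⟩) - ⟨a, b⟩ by rewrite dotBl dotZl mulrA.
move=> wb; have : `‖2%:C * (⟨a, k⟩ * ⟨k, b⟩)‖ <= `‖a‖ * `‖b‖ + `‖⟨a, b⟩‖.
  rewrite -nw -[_ * (_ * _)](subrK ⟨a, b⟩) -wb (le_trans (rnormD _ _))// lerD2r.
  exact: cauchy_schwarz.
by rewrite rnormM rnorm_real ger0_norm// ler_pdivlMl.
Qed.

(** The theorem before taking suprema.  With [A = |Z|] and [P = Z S] the projection
    on the range, [<Z k, k> = <Z k, P k>]; then come Cauchy-Schwarz,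
    Hölder-McCarthy, Buzano and the inequality of the means. *)
Lemma mpinv_quadratic_form Z S (r : R) (k : H) : bounded_op Z -> is_mpinv Z S ->
  1 <= r -> `‖k‖ = 1 ->
  `‖⟨Z k, k⟩‖ `^ (2 * r) <=
    4^-1 * `‖⟨(op_pow (op_abs Z) (4 * r) \+ op_pow (Z \o S) (2 * r)) k, k⟩‖ +
    2^-1 * `‖⟨(op_pow (Z \o S) r \o op_pow (op_abs Z) (2 * r)) k, k⟩‖.
Proof.
move=> bZ [bS ZSZ SZS aZS _] r1 k1.
have r0 : 0 <= r by exact: le_trans r1.
have [bA sA A0 AA] := op_abs_spec bZ; set A := op_abs Z in bA sA A0 AA *.
have bP := bounded_comp bZ bS; have sP := symmetric_adj bP aZS.
set P := Z \o S in bP sP aZS *.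
have PZ u : P (Z u) = Z u by rewrite -[in RHS]ZSZ.
have PP u : P (P u) = P u by exact: PZ.
have r_gt0 : 0 < r by exact: lt_le_trans r1.
rewrite (op_pow_projection bP sP PP r_gt0) (op_pow_projection bP sP PP (mulr_gt0 _ r_gt0))//.
have r21 : 1 <= 2 * r by lra.
have -> : op_pow A (4 * r) = op_pow A (2 * r) \o op_pow A (2 * r).
  by rewrite op_pow_add//; congr op_pow; ring.
have fB := op_powP bA sA A0 r21; have sB := fcalc_symmetric bA sA fB.
have mc := hoelder_mccarthy bA sA A0 r1 k1.
move: (op_pow A (2 * r)) fB sB mc => B fB sB mc /=.
have nA : `‖A k‖ = `‖Z k‖.
  apply/eqP; rewrite -(@eqrXn2 _ 2)// ?rnorm_ge0//; apply/eqP/complexI.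
  by rewrite -!dotuu sA AA (adjP bZ).2.
have nP : `‖P k‖ ^+ 2 = complex.Re ⟨P k, k⟩.
  by have := dotuu (P k); rewrite -sP PP => ->.
have P1 : `‖P k‖ <= 1.
  have [->|/rnorm_gt0 Pk0] := eqVneq (P k) 0; first by rewrite rnorm0.
  rewrite -(ler_pM2l Pk0) -expr2 nP (le_trans (le_Re_rnorm _))//.
  by rewrite (le_trans (cauchy_schwarz _ _))// k1.
have P2 : `‖P k‖ ^+ 2 <= 1 by rewrite expr_le1// rnorm_ge0.
have step1 : `‖⟨Z k, k⟩‖ `^ (2 * r) <= complex.Re ⟨B k, k⟩ * `‖P k‖ ^+ 2.
  rewrite powRrM powR_mulrn ?rnorm_ge0//.
  have h : `‖⟨Z k, k⟩‖ ^+ 2 <= `‖Z k‖ ^+ 2 * `‖P k‖ ^+ 2.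
    rewrite -exprMn ler_pXn2r ?nnegrE ?mulr_ge0 ?rnorm_ge0//.
    by rewrite -{1}PZ sP cauchy_schwarz.
  have := ge0_ler_powR r0 _ _ h; rewrite !nnegrE => /(_ _ _)/le_trans; apply.
  - by rewrite exprn_ge0 ?rnorm_ge0.
  - by rewrite mulr_ge0 ?exprn_ge0 ?rnorm_ge0.
  rewrite powRM ?exprn_ge0 ?rnorm_ge0// ler_pM ?powR_ge0// -?nA//.
  have [->|n0] := eqVneq (`‖P k‖ ^+ 2) 0; first by rewrite powR0// gt_eqF.
  by rewrite ge1r_powR// P2 andbT lt_neqAle eq_sym n0 exprn_ge0 ?rnorm_ge0.
apply: (le_trans step1).
have step2 : complex.Re ⟨B k, k⟩ * `‖P k‖ ^+ 2 <= `‖⟨B k, k⟩ * ⟨k, P k⟩‖.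
  rewrite rnormM ler_pM ?exprn_ge0 ?rnorm_ge0 ?le_Re_rnorm//.
    by rewrite (le_trans _ mc)// powR_ge0.
  by rewrite nP sP le_Re_rnorm.
apply: (le_trans step2); apply: (le_trans (buzano _ _ k1)).
have -> : ⟨B k, P k⟩ = ⟨P (B k), k⟩ by rewrite sP.
have -> : ⟨B (B k) + P k, k⟩ = (`‖B k‖ ^+ 2 + `‖P k‖ ^+ 2)%:C.
  by rewrite dotDl sB -(PP k) sP PP !dotuu -rmorphD.
rewrite rnorm_real ger0_norm ?addr_ge0 ?exprn_ge0 ?rnorm_ge0//.
have := sqr_ge0 (`‖B k‖ - `‖P k‖); lra.
Qed.

(** * Berezin numbers *)

Lemma rnorm_nkernel (x : X) : @rkernel R X H x != 0 -> `‖@nkernel R X H x‖ = 1.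
Proof.
move=> /rnorm_gt0 k0; rewrite /nkernel normCE -fmorphV rnormZr.
by rewrite ger0_norm ?invr_ge0 ?rnorm_ge0// mulVf ?gt_eqF.
Qed.

Lemma le_ber T (x : X) : bounded_op T -> @rkernel R X H x != 0 ->
  `‖⟨T (nkernel x), nkernel x⟩‖ <= ber T.
Proof.
move=> /bounded_opP[_ [M M0 TM]] kx; apply: ub_le_sup; last by exists x.
exists M => _ [y /= ky <-]; rewrite (le_trans (cauchy_schwarz _ _))//.
by have := TM (nkernel y); rewrite rnorm_nkernel// !mulr1.
Qed.

Lemma ber_ge0 T : bounded_op T -> 0 <= ber T.
Proof.
move=> bT; rewrite /ber; set B := [set _ | _ in _].
have [->|/set0P[_ [x kx _]]] := eqVneq B set0; first by rewrite sup0.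
exact: le_trans (rnorm_ge0 _) (le_ber bT kx).
Qed.

Lemma ber_le T (c : R) : 0 <= c ->
  (forall x : X, @rkernel R X H x != 0 -> `‖⟨T (nkernel x), nkernel x⟩‖ <= c) ->
  ber T <= c.
Proof.
move=> c0 Tc; rewrite /ber; set B := [set _ | _ in _].
have [->|/set0P B0] := eqVneq B set0; first by rewrite sup0.
by apply: ge_sup => // _ [x kx <-]; exact: Tc.
Qed.

End PositiveOperators.

Unset Implicit Arguments.
Local Close Scope complex_scope.

Theorem theorem2p7 (R : realType) (X : Type) (X_nonempty : inhabited X)
    (H : rkhs R X) (Z : H -> H) (Z_bounded : bounded_op Z)
    (Z_closed_range : closed (range Z)) (r : R) (r_ge1 : 1 <= r) :
  ber Z `^ (2 * r) <=
    4^-1 * ber (op_pow (op_abs Z) (4 * r) \+ op_pow (Z \o mpinv Z) (2 * r)) +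
    2^-1 * ber (op_pow (Z \o mpinv Z) r \o op_pow (op_abs Z) (2 * r)).
Proof.
have Zmp : is_mpinv Z (mpinv Z).
  apply: (@xgetPex _ (fun=> 0) [set S | is_mpinv Z S]).
  exact: mpinv_exists.
have r2 : 0 < 2 * r by rewrite mulr_gt0// (lt_le_trans _ r_ge1).
set bnd := (X in _ <= X).
have [bA sA A0 _] := op_abs_spec Z_bounded.
have [bS ZSZ _ aZS _] := Zmp.
have bP := bounded_comp Z_bounded bS.
have PE s : 0 < s -> op_pow (Z \o mpinv Z) s = Z \o mpinv Z.
  apply: op_pow_projection => //; first exact: symmetric_adj.
  by move=> u; exact: (congr1 (@^~ (mpinv Z u)) ZSZ).
have bpow s : 1 <= s -> bounded_op (op_pow (op_abs Z) s).
  by move=> s1; have [] := op_powP bA sA A0 s1.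
have bsum : bounded_op (op_pow (op_abs Z) (4 * r) \+ op_pow (Z \o mpinv Z) (2 * r)).
  rewrite PE// (_ : _ \+ _ = fun u => 1 *: op_pow (op_abs Z) (4 * r) u + (Z \o mpinv Z) u).
    by apply: bounded_lin => //; apply: bpow; lra.
  by apply/funext => u; rewrite scale1r.
have bprod : bounded_op (op_pow (Z \o mpinv Z) r \o op_pow (op_abs Z) (2 * r)).
  rewrite PE ?(lt_le_trans _ r_ge1)//; apply: bounded_comp => //.
  by apply: bpow; lra.
have bnd0 : 0 <= bnd by apply: addr_ge0; apply: mulr_ge0 => //; exact: ber_ge0.
have form (x : X) : @rkernel R X H x != 0 ->
    `‖⟨Z (nkernel x), nkernel x⟩‖ `^ (2 * r) <= bnd.
  move=> kx; have q := mpinv_quadratic_form Z_bounded Zmp r_ge1 (rnorm_nkernel kx).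
  apply: (le_trans q).
  by rewrite lerD// ler_wpM2l//; exact: le_ber.
have : ber Z <= bnd `^ (2 * r)^-1.
  apply: ber_le => [|x /form kx]; first exact: powR_ge0.
  have := ge0_ler_powR (r := (2 * r)^-1) _ _ _ kx.
  rewrite -powRrM mulfV ?gt_eqF// powRr1 ?rnorm_ge0//; apply; rewrite ?nnegrE ?powR_ge0//.
  by rewrite invr_ge0 ltW.
move=> /(ge0_ler_powR (ltW r2)); rewrite !nnegrE => /(_ (ber_ge0 Z_bounded) (powR_ge0 _ _)).
by rewrite -powRrM mulVf ?gt_eqF// powRr1.
Qed.
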